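(* Let $f\colon M\rightarrow\mathbb{R}^{5}$ be a non-degenerate affine hypersurface ($\dim M=4$) with a locally equiaffine transversal vector field $\xi$ and an almost symplectic form $\omega$ on $M$. Let $\nabla$, $h$, $S$ be the induced connection, the second fundamental form and the shape operator induced by $\xi$, and let $R$ be the curvature tensor of $\nabla$. If $R^k\cdot\omega=0$ for some integer $k\geq 1$ and the second fundamental form $h$ is Lorentzian on $M$ (that is, has signature $(3,1)$), then the shape operator $S$ has rank $\leq 1$ (at every point of $M$).
   Context: $M$ is a connected orientable smooth $4$-manifold immersed by $f$ in $\mathbb{R}^5$, and $\operatorname{D}$ is the usual flat connection on $\mathbb{R}^5$. For a transversal vector field $\xi$ along $f$, the induced connection $\nabla$ (torsion-free), the second fundamental form $h$ (a symmetric bilinear form), the shape operator $S$ (a $(1,1)$-tensor) and the transversal connection form $\tau$ (a 1-form) are defined by $\operatorname{D}_Xf_*Y=f_*(\nabla_XY)+h(X,Y)\xi$ and $\operatorname{D}_X\xi=-f_*(SX)+\tau(X)\xi$ for tangent vector fields $X,Y$. The vector field $\xi$ is called locally equiaffine if $d\tau=0$. The hypersurface is non-degenerate if $h$ is non-degenerate. An almost symplectic form is a non-degenerate 2-form on $M$ (not necessarily closed). The curvature tensor is $R(X,Y)Z=\nabla_X\nabla_YZ-\nabla_Y\nabla_XZ-\nabla_{[X,Y]}Z$. For a tensor field $T$ of type $(0,p)$, $R\cdot T$ is the tensor field of type $(0,p+2)$ given by $(R\cdot T)(X_1,\ldots,X_{p+2})=-\sum_{i=3}^{p+2}T(X_3,\ldots,R(X_1,X_2)X_i,\ldots,X_{p+2})$;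 and $R^0\cdot T=T$, $R^k\cdot T=R\cdot(R^{k-1}\cdot T)$, a tensor of type $(0,2k+p)$. *)

(* Defs.v *)
From HB Require Import structures.
From mathcomp Require Import all_boot all_order all_algebra.
From mathcomp Require Import all_classical all_reals all_analysis.
From mathcomp Require Import ring.

Set Implicit Arguments.
Unset Strict Implicit.
Unset Printing Implicit Defensive.

Import Order.TTheory GRing.Theory Num.Theory.
Import numFieldNormedType.Exports.

Local Open Scope classical_set_scope.
Local Open Scope ring_scope.

Section SmoothMaps.
Context {R : realType} {V W : normedModType R}.

(* Only meaningful when U is open: the neighbourhoods are those of V. *)
Fixpoint Ck (k : nat) (U : set V) (f : V -> W) : Prop :=
  match k with
  | 0 => forall x, U x -> {for x, continuous f}
  | k'.+1 => (forall x, U x -> differentiable f x) /\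
             (forall v, Ck k' U ('D_v f))
  end.

Definition smooth_on (U : set V) (f : V -> W) : Prop := forall k, Ck k U f.

End SmoothMaps.

Section CkTheory.
Context {R : realType} {V W : normedModType R}.
Implicit Types (U : set V) (f g : V -> W).

Lemma near0_differentiable f x : (\near x, f x = 0) -> differentiable f x.
Proof.
move=> f0; have fx : f x = 0 by exact: nbhs_singleton f0.
have oE : (f \o shift x) = cst (f x) + (0 : V -> W) +o_ 0 id.
  apply/eqaddoP => e e0.
  have : \forall y \near (0 : V), f (y + x) = 0.
    by move: f0; rewrite (near_shift 0 x) subr0.
  apply: filterS => y fy.
  by rewrite !fctE /= fy fx !addr0 subr0 normr0 mulr_ge0// ltW.
have dE : 'd f x = 0 :> (V -> W).
  by apply/diff_unique; first exact: cst_continuous.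
by apply/diff_locallyP; rewrite dE; split; first exact: cst_continuous.
Qed.

Lemma near_differentiable f g x :
  {near x, f =1 g} -> differentiable f x -> differentiable g x.
Proof.
move=> fg df; have -> : g = f + (g - f) by rewrite addrC subrK.
apply: differentiableD => //; apply: near0_differentiable.
by apply: filterS fg => y fgy; rewrite !fctE /= fgy subrr.
Qed.

Lemma open_near U x (P : V -> Prop) :
  open U -> U x -> (forall y, U y -> P y) -> \forall y \near x, P y.
Proof.
by move=> oU Ux UP; have := open_nbhs_nbhs (conj oU Ux); apply: filterS.
Qed.

Lemma Ck_ext k U f g :
  open U -> (forall x, U x -> f x = g x) -> Ck k U f -> Ck k U g.
Proof.
move=> oU; elim: k f g => [|k IH] f g fg /=.
  move=> fc x Ux; rewrite /prop_for /continuous_at -(fg x Ux).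
  by apply: cvg_trans (fc x Ux); apply: near_eq_cvg; exact: open_near fg.
case=> df Df; split=> [x Ux|v].
  by apply: near_differentiable (df x Ux); exact: open_near fg.
by apply: IH (Df v) => x Ux; apply: near_eq_derive; exact: open_near fg.
Qed.

Lemma CkS k U f : Ck k.+1 U f -> Ck k U f.
Proof.
elim: k f => [|k IH] f /= [df Df].
  by move=> x Ux; exact: differentiable_continuous (df x Ux).
by split=> // v; apply: IH; exact: Df.
Qed.

Lemma Ck_lin k U f g (a : R) :
  open U -> Ck k U f -> Ck k U g -> Ck k U (a *: f + g).
Proof.
move=> oU; elim: k f g => [|k IH] f g /=.
  move=> fc gc x Ux; apply: continuousD; last exact: gc.
  by apply: continuousZl_tmp; exact: fc.
move=> [df Df] [dg Dg]; split=> [x Ux|v].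
  by apply: differentiableD; [apply: differentiableZ; exact: df|exact: dg].
apply: Ck_ext (IH _ _ (Df v) (Dg v)) => // x Ux.
have vf : derivable f x v by apply: diff_derivable; exact: df.
have vg : derivable g x v by apply: diff_derivable; exact: dg.
by rewrite deriveD ?deriveZ//; exact: derivableZ.
Qed.

End CkTheory.

Lemma Ck_mul {R : realType} {V : normedModType R} k (U : set V)
    (f g : V -> R) : open U -> Ck k U f -> Ck k U g -> Ck k U (f * g).
Proof.
move=> oU; elim: k f g => [|k IH] f g.
  by move=> fc gc x Ux; apply: continuousM; [exact: fc|exact: gc].
move=> fS gS; have [df Df] := fS; have [dg Dg] := gS; split=> [x Ux|v].
  by apply: differentiableM; [exact: df|exact: dg].
have := Ck_lin 1 oU (IH _ _ (CkS fS) (Dg v)) (IH _ _ (CkS gS) (Df v)).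
apply: Ck_ext => // x Ux.
rewrite scale1r deriveM//; apply: diff_derivable; [exact: df|exact: dg].
Qed.

Section Manifolds.
Context {R : realType} {n : nat}.

(* chart_inv is only relevant on the open set chart_map @` chart_dom. *)
Record chart (M : topologicalType) := Chart {
  chart_dom : set M;
  chart_map : M -> 'rV[R]_n;
  chart_inv : 'rV[R]_n -> M;
  chart_dom_open : open chart_dom;
  chart_img_open : open (chart_map @` chart_dom);
  chart_mapK : {in chart_dom, cancel chart_map chart_inv};
  chart_map_continuous : {in chart_dom, continuous chart_map};
  chart_inv_continuous : {in chart_map @` chart_dom, continuous chart_inv}
}.

Section Transition.
Context {M : topologicalType} (c c' : chart M).

Definition transition : 'rV[R]_n -> 'rV[R]_n := chart_map c' \o chart_inv c.

Definition transition_dom : set 'rV[R]_n :=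
  chart_map c @` (chart_dom c `&` chart_dom c').

End Transition.

Definition smooth_compatible {M : topologicalType} (c c' : chart M) : Prop :=
  smooth_on (transition_dom c c') (transition c c') /\
  smooth_on (transition_dom c' c) (transition c' c).

Record manifold := Manifold {
  manifold_space :> topologicalType;
  atlas : set (chart manifold_space);
  manifold_hausdorff : hausdorff_space manifold_space;
  manifold_second_countable : @second_countable manifold_space;
  atlas_cover : forall p, exists2 c, atlas c & chart_dom c p;
  atlas_compatible : forall c c', atlas c -> atlas c' -> smooth_compatible c c'
}.

(* The oriented charts B need not belong to the given atlas, only to the
   maximal atlas it generates. *)
Definition orientable (M : manifold) : Prop :=
  exists B : set (chart M),
    [/\ forall p, exists2 c, B c & chart_dom c p,
        forall c c', B c -> atlas c' -> smooth_compatible c c' &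
        forall c c', B c -> B c' -> forall x, transition_dom c c' x ->
          0 < \det ('J (transition c c') x)].

End Manifolds.

Arguments chart R n M : clear implicits.
Arguments manifold R n : clear implicits.

Section Tangent.
Context {R : realType} {n : nat} {M : manifold R n}.
Implicit Types (p q : M) (U : set M) (f g : M -> R).

Definition smooth_fun {W : normedModType R} U (f : M -> W) : Prop :=
  forall c, atlas c ->
    smooth_on (chart_map c @` (U `&` chart_dom c)) (f \o chart_inv c).

Definition smooth_near p f : Prop :=
  exists U : set M, [/\ open U, U p & smooth_fun U f].

(* Derivations of the algebra of germs at p of smooth functions, presented as
   functionals on all functions M -> R; deriv_junk makes this presentation
   unique. *)
Record derivation_at p (v : (M -> R) -> R) : Prop := DerivationAt {
  deriv_local : forall f g, smooth_near p f -> {near p, f =1 g} -> v f = v g;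
  deriv_lin : forall (a : R) f g, smooth_near p f -> smooth_near p g ->
    v (a *: f + g) = a * v f + v g;
  deriv_leibniz : forall f g, smooth_near p f -> smooth_near p g ->
    v (f * g) = f p * v g + v f * g p;
  deriv_junk : forall f, ~ smooth_near p f -> v f = 0
}.

Definition derivations p : {pred ((M -> R) -> R)} :=
  mem [set v | derivation_at p v].

Record tangent p := Tangent {
  tangent_fun :> (M -> R) -> R;
  tangent_funP : tangent_fun \in derivations p
}.

HB.instance Definition _ p := [isSub for @tangent_fun p].
HB.instance Definition _ p := [Choice of tangent p by <:].

Lemma derivations_submod_closed p : submod_closed (derivations p).
Proof.
split=> [|a v w].
  rewrite inE /=; split=> //; first by move=> a f g _ _; rewrite mulr0 addr0.
  by move=> f g _ _; rewrite mulr0 mul0r addr0.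
rewrite !inE /= => -[v1 v2 v3 v4] [w1 w2 w3 w4]; split=> [f g sf fg|b f g sf sg|f g sf sg|f sf];
  rewrite !fctE /= /GRing.scale /=.
- by rewrite (v1 _ _ sf fg) (w1 _ _ sf fg).
- by rewrite v2// w2//; ring.
- by rewrite v3// w3//; ring.
- by rewrite v4// w4// mulr0 addr0.
Qed.

HB.instance Definition _ p :=
  GRing.isSubmodClosed.Build R ((M -> R) -> R) (derivations p)
    (derivations_submod_closed p).
HB.instance Definition _ p := [SubChoice_isSubLmodule of tangent p by <:].

Lemma tangentP p (v : tangent p) : derivation_at p v.
Proof. by have := tangent_funP v; rewrite inE. Qed.

Record vfield := VField {
  vfield_at :> forall p, tangent p;
  vfield_smooth : forall U f, open U -> smooth_fun U f ->
    smooth_fun U (fun p => vfield_at p f)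
}.

End Tangent.

Arguments tangent {R n M} p.
Arguments vfield {R n} M.

Section SmoothFunctions.
Context {R : realType} {n : nat} {M : manifold R n}.
Implicit Types (p q : M) (U : set M) (f g : M -> R).

Lemma chart_img_openI (c : chart R n M) U :
  open U -> open (chart_map c @` (U `&` chart_dom c)).
Proof.
move=> oU; rewrite openE => _ [q [Uq cq] <-].
have xI : (chart_map c @` chart_dom c) (chart_map c q) by exists q.
have cc : {for chart_map c q, continuous (chart_inv c)}.
  by apply: chart_inv_continuous; rewrite inE.
have Kq : chart_inv c (chart_map c q) = q by apply: chart_mapK; rewrite inE.
have nU : nbhs (chart_inv c (chart_map c q)) U.
  by rewrite Kq; exact: open_nbhs_nbhs.
have nI := open_nbhs_nbhs (conj (chart_img_open (c:=c)) xI).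
apply: filterS (filterI nI (cc _ nU)) => _ [[r cr <-] /= Ur].
by exists r => //; split=> //; move: Ur; rewrite chart_mapK// inE.
Qed.

Lemma smooth_funS {W : normedModType R} U U' (f : M -> W) :
  U' `<=` U -> smooth_fun U f -> smooth_fun U' f.
Proof.
move=> sU sf c ac k; have {sf} := sf c ac k.
have sI : chart_map c @` (U' `&` chart_dom c)
      `<=` chart_map c @` (U `&` chart_dom c).
  by apply: image_subset; apply: setSI.
elim: k (f \o chart_inv c) => [|k IH] h /=; first by move=> hc x /sI /hc.
by case=> dh Dh; split=> [x /sI /dh//|v]; apply: IH; exact: Dh.
Qed.

Lemma smooth_fun_ext {W : normedModType R} U (f g : M -> W) :
  open U -> (forall q, U q -> f q = g q) -> smooth_fun U f -> smooth_fun U g.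
Proof.
move=> oU fg sf c ac k; apply: Ck_ext (sf c ac k).
  exact: chart_img_openI.
by move=> _ [q [Uq cq] <-] /=; rewrite chart_mapK ?inE//; exact: fg.
Qed.

Lemma smooth_fun_lin {W : normedModType R} U (a : R) (f g : M -> W) :
  open U -> smooth_fun U f -> smooth_fun U g -> smooth_fun U (a *: f + g).
Proof.
move=> oU sf sg c ac k; apply: Ck_lin (sf c ac k) (sg c ac k).
exact: chart_img_openI.
Qed.

Lemma smooth_funM U f g :
  open U -> smooth_fun U f -> smooth_fun U g -> smooth_fun U (f * g).
Proof.
move=> oU sf sg c ac k; apply: Ck_mul (sf c ac k) (sg c ac k).
exact: chart_img_openI.
Qed.

Lemma smooth_near2 p f g : smooth_near p f -> smooth_near p g ->
  exists U, [/\ open U, U p, smooth_fun U f & smooth_fun U g].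
Proof.
case=> U [oU Up sf] [V [oV Vp sg]]; exists (U `&` V); split=> //.
- exact: openI.
- by apply: smooth_funS sf; exact: subIsetl.
- by apply: smooth_funS sg; exact: subIsetr.
Qed.

Lemma smooth_near_lin p (a : R) f g :
  smooth_near p f -> smooth_near p g -> smooth_near p (a *: f + g).
Proof.
move=> sf sg; have [U [oU Up {}sf {}sg]] := smooth_near2 sf sg.
by exists U; split=> //; exact: smooth_fun_lin.
Qed.

Lemma smooth_nearM p f g :
  smooth_near p f -> smooth_near p g -> smooth_near p (f * g).
Proof.
move=> sf sg; have [U [oU Up {}sf {}sg]] := smooth_near2 sf sg.
by exists U; split=> //; exact: smooth_funM.
Qed.

Lemma smooth_near_ext p f g :
  {near p, f =1 g} -> smooth_near p f -> smooth_near p g.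
Proof.
move=> /nbhs_interior fg [U [oU Up sf]].
exists (U `&` (fun q => f q = g q)°); split.
- by apply: openI => //; exact: open_interior.
- by split=> //; exact: nbhs_singleton fg.
- apply: (@smooth_fun_ext _ _ f).
  + by apply: openI => //; exact: open_interior.
  + by move=> q [_ /interior_subset].
  + by apply: smooth_funS sf; exact: subIsetl.
Qed.

Lemma smooth_near_open U p f :
  open U -> U p -> smooth_fun U f -> \forall q \near p, smooth_near q f.
Proof.
move=> oU Up sf; have := open_nbhs_nbhs (conj oU Up).
by apply: filterS => q Uq; exists U.
Qed.

Lemma smooth_near_near p f :
  smooth_near p f -> \forall q \near p, smooth_near q f.
Proof. by case=> U [oU Up sf]; exact: smooth_near_open sf. Qed.

Lemma vfield_smooth_near (X : vfield M) p f :
  smooth_near p f -> smooth_near p (fun q => X q f).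
Proof.
by case=> U [oU Up sf]; exists U; split=> //; exact: vfield_smooth.
Qed.

End SmoothFunctions.

Section VectorFields.
Context {R : realType} {n : nat} {M : manifold R n}.
Implicit Types (p q : M) (X Y Z : vfield M) (f g : M -> R).

Lemma vfield_sub_smooth X Y (U : set M) f : open U -> smooth_fun U f ->
  smooth_fun U (fun p => (X p - Y p : tangent p) f).
Proof.
move=> oU sf.
have := smooth_fun_lin (-1) oU (vfield_smooth Y oU sf) (vfield_smooth X oU sf).
by apply: smooth_fun_ext => // q Uq; rewrite !fctE /= scaleN1r addrC.
Qed.

Definition vfield_sub X Y : vfield M := VField (vfield_sub_smooth X Y).

Definition bracket_fun X Y p f : R :=
  if `[< smooth_near p f >]
  then X p (fun q => Y q f) - Y p (fun q => X q f) else 0.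

Lemma bracket_half X Y p f g : smooth_near p f -> smooth_near p g ->
  X p (fun q => Y q (f * g)) =
  X p f * Y p g + f p * X p (fun q => Y q g)
  + (X p (fun q => Y q f) * g p + Y p f * X p g).
Proof.
move=> sf sg; have := tangentP (X p) => -[Xloc Xlin Xleib _].
have sYf := vfield_smooth_near Y sf; have sYg := vfield_smooth_near Y sg.
have E : {near p, 1 *: (f * (fun q => Y q g)) + (fun q => Y q f) * g
               =1 (fun q => Y q (f * g))}.
  apply: filterS (filterI (smooth_near_near sf) (smooth_near_near sg)) => q [??].
  by rewrite (deriv_leibniz (tangentP (Y q)))// scale1r.
rewrite -(Xloc _ _ _ E); last first.
  by apply: smooth_near_lin; apply: smooth_nearM.
rewrite Xlin; [|exact: smooth_nearM|exact: smooth_nearM].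
rewrite !Xleib//; ring.
Qed.

Lemma bracket_subproof X Y p : bracket_fun X Y p \in derivations p.
Proof.
have loc (Z Z' : vfield M) f g : smooth_near p f -> {near p, f =1 g} ->
    Z p (fun q => Z' q f) = Z p (fun q => Z' q g).
  move=> sf fg; apply: (deriv_local (tangentP (Z p))).
    exact: vfield_smooth_near.
  apply: filterS (filterI (smooth_near_near sf) (nbhs_interior fg)) => q [sq fgq].
  by apply: (deriv_local (tangentP (Z' q))).
have lin (Z Z' : vfield M) a f g : smooth_near p f -> smooth_near p g ->
    Z p (fun q => Z' q (a *: f + g)) =
    a * Z p (fun q => Z' q f) + Z p (fun q => Z' q g).
  move=> sf sg; have sZf := vfield_smooth_near Z' sf.
  have sZg := vfield_smooth_near Z' sg.
  rewrite -(deriv_lin (tangentP (Z p)) a sZf sZg); symmetry.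
  apply: (deriv_local (tangentP (Z p))); first exact: smooth_near_lin.
  apply: filterS (filterI (smooth_near_near sf) (smooth_near_near sg)) => q [??].
  by rewrite (deriv_lin (tangentP (Z' q))).
rewrite inE /bracket_fun /=; split=> [f g sf fg|a f g sf sg|f g sf sg|f sf].
- have sg := smooth_near_ext fg sf.
  by rewrite !asboolT// (loc X Y f g)// (loc Y X f g).
- have sfg := smooth_near_lin a sf sg.
  by rewrite !asboolT// !lin//; ring.
- have sfg := smooth_nearM sf sg.
  by rewrite !asboolT// !bracket_half//; ring.
- by rewrite asboolF.
Qed.

Lemma bracket_smooth X Y (U : set M) f : open U -> smooth_fun U f ->
  smooth_fun U (fun p => Tangent (bracket_subproof X Y p) f).
Proof.
move=> oU sf.
have sYX := vfield_smooth Y oU (vfield_smooth X oU sf).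
have sXY := vfield_smooth X oU (vfield_smooth Y oU sf).
have := smooth_fun_lin (-1) oU sYX sXY.
apply: smooth_fun_ext => // q Uq.
have sq : smooth_near q f by exists U.
by rewrite !fctE /= /bracket_fun asboolT// scaleN1r addrC.
Qed.

Definition bracket X Y : vfield M := VField (bracket_smooth X Y).

End VectorFields.

Section TensorFields.
Context {R : realType} {n : nat} (M : manifold R n).

Record form1 := Form1 {
  form1_at :> forall p : M, {scalar tangent p};
  form1_smooth : forall X : vfield M,
    smooth_fun setT (fun p => form1_at p (X p))
}.

Record bilinear_field := BilinearField {
  bilinear_at :> forall p : M, {biscalar tangent p};
  bilinear_smooth : forall X Y : vfield M,
    smooth_fun setT (fun p => bilinear_at p (X p) (Y p))
}.

Record endo_field := EndoField {
  endo_at :> forall p : M, {linear tangent p -> tangent p};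
  endo_smooth : forall (X : vfield M) (U : set M) (f : M -> R),
    open U -> smooth_fun U f -> smooth_fun U (fun p => endo_at p (X p) f)
}.

(* d tau = 0, by d tau (X, Y) = X (tau Y) - Y (tau X) - tau [X, Y]. *)
Definition closed1 (tau : form1) : Prop :=
  forall (X Y : vfield M) (p : M),
    X p (fun q => tau q (Y q)) - Y p (fun q => tau q (X q))
    - tau p (bracket X Y p) = 0.

Definition nondegenerate_field (b : bilinear_field) : Prop :=
  forall (p : M) (u : tangent p), (forall v, b p u v = 0) -> u = 0.

Definition alternating_field (b : bilinear_field) : Prop :=
  forall (p : M) (u : tangent p), b p u u = 0.

Definition almost_symplectic (omega : bilinear_field) : Prop :=
  alternating_field omega /\ nondegenerate_field omega.

End TensorFields.

Section LinearAlgebra.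
Context {R : realType} {V : lmodType R}.

Definition is_basis k (e : 'I_k -> V) : Prop :=
  forall v, exists! c : 'rV[R]_k, v = \sum_i c 0 i *: e i.

Definition has_signature (b : {biscalar V}) (r s : nat) : Prop :=
  exists2 e : 'I_(r + s) -> V, is_basis e &
    forall i j, b (e i) (e j) = if i == j then (if (i < r)%N then 1 else -1) else 0.

Definition rank_le (phi : {linear V -> V}) (r : nat) : Prop :=
  exists w : 'I_r -> V, forall v, exists c : 'rV[R]_r,
    phi v = \sum_i c 0 i *: w i.

End LinearAlgebra.

Section Curvature.
Context {R : realType} {n : nat} {M : manifold R n}.
Variable nabla : vfield M -> vfield M -> vfield M.

Definition curvature (X Y Z : vfield M) : vfield M :=
  vfield_sub (vfield_sub (nabla X (nabla Y Z)) (nabla Y (nabla X Z)))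
             (nabla (bracket X Y) Z).

Definition covariant (p : nat) : Type := ('I_p -> vfield M) -> M -> R.

Definition curv_act p (T : covariant p) : covariant p.+2 := fun X q =>
  let tl i := X (lift ord0 (lift ord0 i)) in
  - \sum_(i < p)
      T (fun j => if j == i
                  then curvature (X ord0) (X (lift ord0 ord0)) (tl i)
                  else tl j) q.

Fixpoint curv_pow p (T : covariant p) (k : nat) : covariant (k.*2 + p) :=
  match k return covariant (k.*2 + p) with
  | 0 => T
  | k'.+1 => curv_act (@curv_pow p T k')
  end.

Definition covariant_of (b : bilinear_field M) : covariant 2 :=
  fun X q => b q (X ord0 q) (X ord_max q).

End Curvature.

Arguments curv_pow {R n M} nabla {p} T k _ _.

Section Hypersurfaces.
Context {R : realType} {n : nat} {M : manifold R n}.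

(* dirder v F is F_* v when F is a map into R^m, and D_v F when F is a vector
   field along such a map. *)
Definition dirder {m} {p : M} (v : tangent p) (F : M -> 'rV[R]_m) : 'rV[R]_m :=
  \row_a v (fun q => F q 0 a).

Definition immersion {m} (f : M -> 'rV[R]_m) : Prop :=
  smooth_fun setT f /\ forall p, injective (fun v : tangent p => dirder v f).

(* At each point, the ambient space is the direct sum of f_* T_p M and of the
   line spanned by xi p. *)
Definition transversal_field {m} (f xi : M -> 'rV[R]_m) : Prop :=
  smooth_fun setT xi /\
  forall p,
    (forall w, exists (v : tangent p) (a : R), w = dirder v f + a *: xi p) /\
    (forall (v : tangent p) (a : R), dirder v f + a *: xi p = 0 ->
       dirder v f = 0 /\ a = 0).

Definition induced_by (f xi : M -> 'rV[R]_n.+1)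
    (nabla : vfield M -> vfield M -> vfield M) (h : bilinear_field M)
    (S : endo_field M) (tau : form1 M) : Prop :=
  (forall (X Y : vfield M) (p : M),
     dirder (X p) (fun q => dirder (Y q) f)
     = dirder (nabla X Y p) f + h p (X p) (Y p) *: xi p) /\
  (forall (X : vfield M) (p : M),
     dirder (X p) xi = - dirder (S p (X p)) f + tau p (X p) *: xi p).

End Hypersurfaces.

(* Main.v *)
Require Import Defs.
From HB Require Import structures.
From mathcomp Require Import all_boot all_order all_algebra.
From mathcomp Require Import all_classical all_reals all_analysis.
From mathcomp Require Import ring lra.

Set Implicit Arguments.
Unset Strict Implicit.
Unset Printing Implicit Defensive.

Import Order.TTheory GRing.Theory Num.Theory.
Import numFieldNormedType.Exports.

Local Open Scope classical_set_scope.
Local Open Scope ring_scope.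

(** The Gauss equation R(X,Y)Z = h(Y,Z)SX - h(X,Z)SY and, since dtau = 0, the
    h-symmetry of S reduce everything to linear algebra in one tangent space.
    Let T_k = R^k omega (up to sign) and fix all arguments of T_(j+1) but the
    first two: this gives an alternating form g.  If T_(j+2) = 0, commuting two
    curvature operators turns into the identity h (.) c = s (.) g of
    Kulkarni-Nomizu type, where s(x,y) = h(Sx,y) and
    c(x,y) = g(Sx,y) + g(x,Sy).  Its trace gives c = t g with 3t = tr S, hence
    (s - t h) (.) g = 0; so if g <> 0, then g is decomposable and S = t on
    ker g.  As h is Lorentzian, ker g contains a non-null vector z; applying the
    same to the forms R(z,w).g forces S - t to have rank at most 1, and then
    either S has rank at most 1 or S^2 = t S with t <> 0.  In the latter case
    the same descent works with arguments taken in the image of S.  Otherwise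
    g = 0, i.e. T_(j+1) = 0, and the descent ends with R.omega = 0, whose trace
    gives S = 0. *)

(** * Linear and bilinear maps built from plain functions *)

Section Packing.
Context {R : nzRingType} {V : lmodType R}.

Lemma scalar_pack (f : V -> R) : scalar f ->
  exists F : {scalar V}, forall x, F x = f x.
Proof.
move=> fl; pose m := GRing.isLinear.Build R V R *%R f fl.
by pose F : {scalar V} := HB.pack f m; exists F.
Qed.

Lemma biscalar_pack (g : V -> V -> R) :
  (forall z, scalar (g z)) -> (forall z, scalar (g^~ z)) ->
  exists G : {biscalar V}, forall x y, G x y = g x y.
Proof.
move=> gr gl; pose m := bilinear_isBilinear.Build R V V R *%R *%R g (gl, gr).
by pose G : {biscalar V} := HB.pack g m; exists G.
Qed.

End Packing.

(** * Endomorphisms acting as derivations on multilinear functions *)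

Section Derivation.
Context {R : comNzRingType} {V : lmodType R}.
Implicit Types (A B : V -> V) (T : seq V -> R) (l m : seq V).

(** The action of [A] on a covariant tensor, without the conventional minus sign. Arguments form a
    list, so that tensors of all orders share one type and no cast between arities is needed. *)
Fixpoint derivation A T l : R :=
  if l is x :: m then T (A x :: m) + derivation A (fun m => T (x :: m)) m
  else 0.

Definition multilinear T := forall l m, scalar (fun x => T (l ++ x :: m)).

Lemma multilinear_cons T x : multilinear T -> multilinear (fun m => T (x :: m)).
Proof. by move=> Tl l m; exact: (Tl (x :: l)). Qed.

Lemma eq_derivation A T T' l : (forall m, size m = size l -> T m = T' m) ->
  derivation A T l = derivation A T' l.
Proof.
elim: l T T' => //= x l IH T T' TT'; rewrite TT'//; congr (_ + _).
by apply: IH => m ml; rewrite TT'//= ml.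
Qed.

Lemma derivation0 A T l : (forall m, size m = size l -> T m = 0) ->
  derivation A T l = 0.
Proof.
elim: l T => //= x l IH T T0; rewrite T0// add0r IH// => m ml.
by rewrite T0//= ml.
Qed.

Lemma derivationP A a T T' l :
  derivation A (fun m => a * T m + T' m) l =
  a * derivation A T l + derivation A T' l.
Proof.
elim: l T T' => /= [|x l IH] T T'; first by rewrite mulr0 addr0.
by rewrite IH; ring.
Qed.

Lemma derivationD A T T' l :
  derivation A (fun m => T m + T' m) l = derivation A T l + derivation A T' l.
Proof.
rewrite -[derivation A T l]mul1r -derivationP.
by apply: eq_derivation => m _; rewrite mul1r.
Qed.

Lemma derivationZ A a T l :
  derivation A (fun m => a * T m) l = a * derivation A T l.
Proof.
rewrite -[RHS]addr0 -(@derivation0 A (fun=> 0) l)//.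
by rewrite -derivationP; apply: eq_derivation => m _; rewrite addr0.
Qed.

Lemma derivationN A T l :
  derivation A (fun m => - T m) l = - derivation A T l.
Proof.
rewrite -mulN1r -derivationZ; apply: eq_derivation => m _.
by rewrite mulN1r.
Qed.

Lemma derivation_opP A B C a T l : multilinear T ->
  (forall v, C v = a *: A v + B v) ->
  derivation C T l = a * derivation A T l + derivation B T l.
Proof.
move=> Tl Cv; elim: l T Tl => /= [|x l IH] T Tl; first by rewrite mulr0 addr0.
rewrite IH; last exact: multilinear_cons.
by rewrite Cv (Tl [::]) /=; ring.
Qed.

Lemma derivation_op0 A T l : multilinear T -> (forall v, A v = 0) ->
  derivation A T l = 0.
Proof.
(* A zero operator satisfies A = (-1) A + A, and linearity in the operator makes the right-hand side
   cancel. *)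
move=> Tl A0; have := @derivation_opP A A A (-1) T l Tl.
by rewrite mulN1r addNr; apply => v; rewrite A0 scaler0 addr0.
Qed.

Lemma derivation_multilinear A T : linear A -> multilinear T ->
  multilinear (derivation A T).
Proof.
move=> Al Tl l; elim: l T Tl => [|u l IH] T Tl m a x y /=.
  rewrite Al (Tl [::]) /=.
  rewrite (@eq_derivation _ _ (fun m => a * T (x :: m) + T (y :: m))).
    by rewrite derivationP; ring.
  by move=> k _; rewrite (Tl [::]).
rewrite (Tl (_ :: l)) (IH (fun m => T (u :: m)) (multilinear_cons u Tl)); ring.
Qed.

(** Terms in which [A] and [B] hit different arguments cancel. On a common argument the outer
    derivation reaches the vector first, which reverses the order of composition. *)
Lemma derivation_commutator A B T l : multilinear T ->
  derivation A (derivation B T) l - derivation B (derivation A T) l =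
  derivation (fun v => B (A v) - A (B v)) T l.
Proof.
elim: l T => /= [|x l IH] T Tl; first by rewrite subrr.
have := IH _ (multilinear_cons x Tl) => <-.
rewrite !derivationD.
have := Tl [::] l (-1) (A (B x)) (B (A x)).
rewrite /= scaleN1r [- _ + _]addrC => -> /=.
ring.
Qed.

(** Bridge to the indexed sum by which [curv_act] is defined. *)
Lemma derivation_sum A T n (v : 'I_n -> V) :
  derivation A T [seq v i | i <- enum 'I_n] =
  \sum_(i < n) T [seq (if j == i then A (v i) else v j) | j <- enum 'I_n].
Proof.
elim: n T v => [|n IH] T v.
  by rewrite big_ord0 [enum 'I_0]size0nil ?size_enum_ord.
rewrite enum_ordSl /= -map_comp IH big_ord_recl /= -map_comp; congr (T _ + _).
by apply: eq_bigr => i _ /=; rewrite -map_comp.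
Qed.

End Derivation.

(** * Linear algebra of a Lorentzian form in dimension 4 *)

Section LorentzAlgebra.
Context {R : realFieldType} {V : lmodType R}.
Variables (h : {biscalar V}) (S : {linear V -> V}) (e : 'I_4 -> V).

Let sgn (i : 'I_4) : R := if (i < 3)%N then 1 else -1.

Hypothesis h_sym : forall x y, h x y = h y x.
Hypothesis e_orth : forall i j, h (e i) (e j) = if i == j then sgn i else 0.
Hypothesis e_expand : forall v, v = \sum_i (sgn i * h v (e i)) *: e i.
Hypothesis S_sym : forall x y, h (S x) y = h x (S y).

(** The trace with respect to [h], computed in the orthonormal basis [e]; for [s] below it is the
    trace of [S]. *)
Let contract (F : V -> V -> R) : R := \sum_i sgn i * F (e i) (e i).

(* Stated for the fixed module V: the generic rules also match the
   multiplication of R, which is a canonical bilinear map. *)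
Section FormRules.
Variable b : {biscalar V}.

Lemma formDl z : {morph b^~ z : x y / x + y}. Proof. exact: linearDl. Qed.
Lemma formDr z : {morph b z : x y / x + y}. Proof. exact: linearDr. Qed.
Lemma formBl z : {morph b^~ z : x y / x - y}. Proof. exact: linearBl. Qed.
Lemma formBr z : {morph b z : x y / x - y}. Proof. exact: linearBr. Qed.
Lemma formNl z : {morph b^~ z : x / - x}. Proof. exact: linearNl. Qed.
Lemma formZl a x y : b (a *: x) y = a * b x y. Proof. exact: linearZl_LR. Qed.
Lemma formZr a x y : b x (a *: y) = a * b x y. Proof. exact: linearZr_LR. Qed.
Lemma formPl z : scalar (b^~ z). Proof. exact: linearPl. Qed.
Lemma formPr z : scalar (b z). Proof. exact: linearPr. Qed.

End FormRules.

Lemma sgn2 i : sgn i * sgn i = 1.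
Proof. by rewrite /sgn; case: ifP; rewrite ?mulr1 ?mulrNN ?mulr1. Qed.

Lemma contract_hr (f : {scalar V}) v : contract (fun w x => h v w * f x) = f v.
Proof.
rewrite [in RHS](e_expand v) linear_sum /contract; apply: eq_bigr => i _.
by rewrite linearZ /= mulrA.
Qed.

Lemma contract_h : contract h = 4.
Proof.
rewrite /contract (eq_bigr (fun=> 1)) => [|i _].
  by rewrite sumr_const card_ord.
by rewrite e_orth eqxx sgn2.
Qed.

Lemma contractD F G :
  contract (fun x y => F x y + G x y) = contract F + contract G.
Proof. by rewrite -big_split; apply: eq_bigr => i _ /=; rewrite mulrDr. Qed.

Lemma contractZ a F : contract (fun x y => a * F x y) = a * contract F.
Proof. by rewrite big_distrr; apply: eq_bigr => i _ /=; rewrite mulrCA. Qed.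

Lemma eq_contract F G : (forall x y, F x y = G x y) -> contract F = contract G.
Proof. by move=> FG; apply: eq_bigr => i _; rewrite FG. Qed.

Lemma h_nondeg v : (forall x, h v x = 0) -> v = 0.
Proof.
by move=> v0; rewrite [v]e_expand big1// => i _; rewrite v0 mulr0 scale0r.
Qed.

Lemma h_ext u v : (forall x, h u x = h v x) -> u = v.
Proof.
move=> uv; apply/eqP; rewrite -subr_eq0; apply/eqP/h_nondeg => x.
by rewrite formBl uv subrr.
Qed.

Lemma riesz (f : {scalar V}) : exists b, forall x, f x = h b x.
Proof.
exists (\sum_i (sgn i * f (e i)) *: e i) => x.
rewrite linear_sumlz [in LHS](e_expand x) linear_sum.
apply: eq_bigr => i _; rewrite linearZ formZl /= [h (e i) x]h_sym; ring.
Qed.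

Lemma h_normE v : h v v = \sum_i sgn i * h v (e i) ^+ 2.
Proof.
transitivity (h (\sum_i (sgn i * h v (e i)) *: e i) v).
  by rewrite -e_expand.
rewrite linear_sumlz; apply: eq_bigr => i _.
by rewrite formZl /= [h (e i) v]h_sym; ring.
Qed.

Lemma space_normE v : h v (e ord_max) = 0 ->
  h v v = \sum_(i < 3) h v (e (widen_ord (leqnSn 3) i)) ^+ 2.
Proof.
move=> v0; rewrite h_normE big_ord_recr /= v0 expr0n mulr0 addr0.
by apply: eq_bigr => i _; rewrite /sgn /= ltn_ord mul1r.
Qed.

(** The form [h] is positive definite on the orthogonal complement of the timelike vector
    [e ord_max], where it is a sum of three squares. *)
Lemma space_null v : h v (e ord_max) = 0 -> h v v = 0 -> v = 0.
Proof.
move=> v0; rewrite space_normE// => /eqP.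
rewrite psumr_eq0 => [/allP n0|i _]; last exact: sqr_ge0.
rewrite [v]e_expand big_ord_recr /= v0 mulr0 scale0r addr0 big1// => i _.
have := n0 i (mem_index_enum _); rewrite sqrf_eq0 => /eqP ->.
by rewrite mulr0 scale0r.
Qed.

(** Two linear conditions on the three-dimensional span of the spacelike basis vectors leave a
    nonzero solution, and [h] is definite there. *)
Lemma space_perp a b : exists z, [/\ h z a = 0, h z b = 0 & h z z != 0].
Proof.
pose E i := e (widen_ord (leqnSn 3) i).
pose M : 'M[R]_(3, 2) := \matrix_(i, j) h (E i) (if j == ord0 then a else b).
have : kermx M != 0.
  rewrite -mxrank_eq0 mxrank_ker subn_eq0 -ltnNge.
  exact: leq_ltn_trans (rank_leq_col _) _.
case/rowV0Pn => u /sub_kermxP uM u0.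
pose z := \sum_i u 0 i *: E i.
have zP c : h z c = \sum_i u 0 i * h (E i) c.
  by rewrite linear_sumlz; apply: eq_bigr => i _; rewrite formZl.
have zM (j : 'I_2) : h z (if j == ord0 then a else b) = 0.
  move/matrixP: uM => /(_ 0 j); rewrite !mxE => <-; rewrite zP.
  by apply: eq_bigr => i _; rewrite mxE.
have zE j : h z (E j) = u 0 j.
  rewrite zP (bigD1 j)//= big1 ?addr0 => [|i ij].
    by rewrite /E e_orth eqxx /sgn /= ltn_ord mulr1.
  rewrite /E e_orth ifF ?mulr0//; apply/negbTE; apply: contra ij.
  by move=> /eqP /(congr1 val) /= /val_inj ->.
have zm : h z (e ord_max) = 0.
  rewrite zP big1// => i _; rewrite /E e_orth ifF ?mulr0//.
  by apply/eqP => /(congr1 val) /= i3; have := ltn_ord i; rewrite i3.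
exists z; split; [exact: (zM ord0)|exact: (zM ord_max)|].
rewrite space_normE//; apply: contra u0; rewrite psumr_eq0 => [/allP n0|i _].
  apply/eqP/rowP => i; have := n0 i (mem_index_enum _).
  by rewrite [h z _](zE i) sqrf_eq0 mxE => /eqP.
exact: sqr_ge0.
Qed.

Definition line_image := exists w, forall v, exists c : R, S v = c *: w.

Lemma line_image0 : (forall x, S x = 0) -> line_image.
Proof. by move=> S0; exists 0 => v; exists 0; rewrite S0 scaler0. Qed.

(** A totally isotropic subspace of a Lorentzian space is at most a line: subtracting a multiple of
    [n] removes the timelike component, and a null vector without one is zero. *)
Lemma isotropic_line_image : (forall x y, h (S x) (S y) = 0) -> line_image.
Proof.
move=> S0.
have [/line_image0//|/existsNP[x0 /eqP Sx0]] := pselect (forall x, S x = 0).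
exists (S x0) => v; set n := S x0.
have n3 : h n (e ord_max) != 0.
  by apply: contra Sx0 => /eqP n3; apply/eqP/space_null => //; exact: S0.
exists (h (S v) (e ord_max) / h n (e ord_max)); apply/eqP; rewrite -subr_eq0.
apply/eqP/space_null.
  by rewrite formBl formZl /= divfK// subrr.
by rewrite /n -linearZ -linearB S0.
Qed.

(** * Admissible forms and their kernels *)

Let s x y := h (S x) y.

Lemma s_sym x y : s x y = s y x.
Proof. by rewrite /s S_sym h_sym. Qed.

(* The Kulkarni-Nomizu-type product a (.) b of the header, for a symmetric and
   b alternating. *)
Definition kn (a b : V -> V -> R) z w x y :=
  a w x * b z y - a z x * b w y - a w y * b z x + a z y * b w x.

Definition cform (g : V -> V -> R) x y := g (S x) y + g x (S y).

(** Isolates what is used of the form g, so that the same lemmas serve for g and for the forms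
    R(z,w).g. *)
Definition admissible (g : V -> V -> R) :=
  (forall x, g x x = 0) /\
  forall x y z w, kn h (cform g) z w x y = kn s g z w x y.

Let t : R := contract s / 3.

Section Admissible.
Variable g : {biscalar V}.
Hypothesis g_adm : admissible g.

Lemma alt_anti x y : g x y = - g y x.
Proof.
have := g_adm.1 (x + y); rewrite formDl !formDr !g_adm.1 add0r addr0.
by move/eqP; rewrite addr_eq0 => /eqP.
Qed.

Lemma cform_linr z : exists F : {scalar V}, forall x, F x = cform g z x.
Proof.
apply: scalar_pack => a x y; rewrite /cform !linearP /=; ring.
Qed.

Lemma cform_anti x y : cform g x y = - cform g y x.
Proof. by rewrite /cform [g (S x) y]alt_anti [g x _]alt_anti; ring. Qed.

(** Trace of the admissibility identity over its second and third arguments. The [h] side gives (4 -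
    1 - 1) c, the [s] side gives (tr S) g - c; the traces of the alternating forms vanish. Hence 3 c
    = (tr S) g, which explains the 3 in [t]. *)
Lemma cformE x y : cform g x y = t * g x y.
Proof.
pose z := x; have [F Fc] := cform_linr z; have [G Gc] := cform_linr y.
have /eq_contract E : forall w u, kn h (cform g) z w u y = kn s g z w u y.
  by move=> w u; exact: g_adm.2.
have L : contract (fun w u => kn h (cform g) z w u y) = 2 * cform g x y.
  transitivity (contract (fun w u => cform g z y * h w u + h z u * G w
       + (-1 * (h y w * F u) + h z y * cform g w u))).
    apply: eq_contract => w u; rewrite /kn Fc Gc [cform g w y]cform_anti.
    by rewrite [h w y]h_sym; ring.
  rewrite !contractD !contractZ contract_hr contract_h.
  rewrite (_ : contract (fun w u => h z u * G w) = G z); last first.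
    by rewrite -(contract_hr G z); apply: eq_bigr.
  rewrite (_ : contract (cform g) = 0); last first.
    rewrite /contract big1// => i _; rewrite /cform.
    by rewrite [g (S _) _]alt_anti addNr mulr0.
  by rewrite Fc Gc [cform g y z]cform_anti /z; ring.
have {L} : 2 * cform g x y = 3 * t * g x y - cform g x y.
  rewrite -L E.
  pose F1 := [the {scalar V} of g z]; pose G1 := [the {scalar V} of g y].
  transitivity (contract (fun w u => g z y * s w u + h (S z) u * G1 w
       + (-1 * (h (S y) w * F1 u) + s z y * g w u))).
    apply: eq_contract => w u; rewrite /kn /F1 /G1 /= [g w y]alt_anti.
    by rewrite [s w y]s_sym /s; ring.
  rewrite !contractD !contractZ contract_hr.
  rewrite (_ : contract (fun w u => h (S z) u * G1 w) = G1 (S z)); last first.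
    by rewrite -(contract_hr G1 (S z)); apply: eq_bigr.
  rewrite (_ : contract g = 0); last first.
    by rewrite /contract big1// => i _; rewrite g_adm.1 mulr0.
  by rewrite /G1 /F1 /= [g y _]alt_anti /cform /t /z; field.
lra.
Qed.

Let s' x y := s x y - t * h x y.

Lemma s'_sym x y : s' x y = s' y x.
Proof. by rewrite /s' s_sym h_sym. Qed.

Lemma kn_s'0 x y z w : kn s' g z w x y = 0.
Proof.
have := g_adm.2 x y z w; rewrite /kn !cformE /s' => E; lra.
Qed.

Lemma s'E x y : s' x y = h (S x - t *: x) y.
Proof. by rewrite /s' /s formBl formZl. Qed.

(** For [u] in the kernel of [g], [kn_s'0] collapses to s'(u,x) g(z,y) = s'(u,y) g(z,x). Choosing
    arguments among [a] and [b] first gives s'(u,a) = 0, then s'(u,x) = 0 for all x. *)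
Lemma ker_eigen a b u :
  g a b != 0 -> (forall x, g u x = 0) -> S u = t *: u.
Proof.
move=> gab ku; suff s'u x : s' u x = 0.
  by apply/eqP; rewrite -subr_eq0; apply/eqP/h_nondeg => x; rewrite -s'E.
have K x' y z : s' u x' * g z y = s' u y * g z x'.
  have := kn_s'0 x' y z u; rewrite /kn !ku !mulr0 subr0 addr0.
  by move/eqP; rewrite subr_eq0 => /eqP.
have s'ua : s' u a = 0.
  have /eqP := K a b a.
  by rewrite g_adm.1 mulr0 mulf_eq0 (negPf gab) orbF => /eqP.
have /eqP := K x a b; rewrite s'ua mul0r alt_anti mulrN oppr_eq0.
by rewrite mulf_eq0 (negPf gab) orbF => /eqP.
Qed.

Lemma admissible_kernel a b : g a b != 0 ->
  (forall x, S x = 0) \/ exists2 z, (forall x, g z x = 0) & h z z != 0.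
Proof.
move=> gab.
have [s'0|/existsNP[x0 /eqP s'x0]] := pselect (forall x, s' x x = 0).
  (* By polarization s' = 0, so S = t. Then c = 2 t g, while [cformE] says c = t g, which forces t =
     0. *)
  left=> x; have St v : S v = t *: v.
    apply/eqP; rewrite -subr_eq0; apply/eqP/h_nondeg => y; rewrite -s'E.
    have := s'0 (v + y); have := s'0 v; have := s'0 y; have := s'_sym v y.
    rewrite /s' /s !linearD /= !formDl /=; lra.
  have := cformE a b; rewrite /cform !St formZl formZr /= => E.
  have /eqP : t * g a b = 0 by lra.
  by rewrite mulf_eq0 (negPf gab) orbF => /eqP ->; rewrite scale0r.
(* The vector [z] is chosen so that s'(z,x0) = 0 and g(z,x0) = 0; [kn_s'0] then reduces to s'(x0,x0)
   g(z,x) = 0. *)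
right; have [c gc] := riesz [the {scalar V} of g x0].
have [z [za zc zz]] := space_perp (S x0 - t *: x0) c; exists z => // x.
have := kn_s'0 x0 x z x0; rewrite /kn g_adm.1 mulr0 addr0.
rewrite [s' z x0]s'_sym [s' x0 z]s'E [h _ z]h_sym za mul0r subr0.
rewrite [g z x0]alt_anti.
have -> : g x0 z = 0 by rewrite -zc h_sym -gc.
by rewrite oppr0 mulr0 subr0 => /eqP; rewrite mulf_eq0 (negPf s'x0) => /eqP.
Qed.

End Admissible.

(** The curvature operator R(z,w), as the Gauss equation expresses it. *)
Definition gauss z w x := h w x *: S z - h z x *: S w.

Lemma admissible_structure (g : {biscalar V}) a b :
  admissible g ->
  (forall z w, exists2 g' : {biscalar V}, admissible g' &
     forall x y, g' x y = g (gauss z w x) y + g x (gauss z w y)) ->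
  g a b != 0 ->
  line_image \/ (t != 0 /\ forall v, S (S v) = t *: S v).
Proof.
move=> g_adm g_cl gab.
have [/line_image0|[z kz zz]] := admissible_kernel g_adm gab; first by left.
have Sz := ker_eigen g_adm gab kz.
have [gS0|/existsNP[w /existsNP[y0 /eqP q0]]] :=
    pselect (forall w y, g (S w) y = 0).
  (* Here c = 0 and hence t = 0. The image of S lies in the kernel of g, where S = t = 0, so the
     image is isotropic. *)
  have := cformE g_adm a b; rewrite /cform [g a _](alt_anti g_adm) !gS0.
  rewrite oppr0 addr0 => /esym/eqP.
  rewrite mulf_eq0 (negPf gab) orbF => /eqP t0.
  left; apply: isotropic_line_image => x y.
  by rewrite -S_sym (ker_eigen g_adm gab (gS0 x)) t0 scale0r linear0l.
pose psi u := g (S w) u; pose q := psi y0.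
have [g' g'_adm g'E] := g_cl z w.
(* Since [z] lies in the kernel of [g] and S z = t z, the form R(z,w).g is the wedge product of
   [psi] and h(z,.). *)
have {}g'E x y : g' x y = psi x * h z y - h z x * psi y.
  rewrite g'E /gauss Sz formBl formBr !formZl !formZr /=.
  by rewrite [g x z](alt_anti g_adm) !kz [g x (S w)](alt_anti g_adm) /psi; ring.
have psiz : psi z = 0 by rewrite /psi (alt_anti g_adm) kz oppr0.
have g'0 : g' z y0 != 0.
  by rewrite g'E psiz mul0r sub0r oppr_eq0 mulf_neq0.
(* As [z] is non-null, [u] splits into a multiple of [z] and a vector [u1] orthogonal to [z]. The
   latter is in the kernel of [g'], so S = t on both parts. *)
have ker_psi u : psi u = 0 -> S u = t *: u.
  move=> pu; pose u1 := u - (h z u / h z z) *: z.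
  have pu1 : psi u1 = 0.
    by rewrite /psi formBr formZr /= -!/(psi _) pu psiz; ring.
  have zu1 : h z u1 = 0 by rewrite formBr formZr /= divfK// subrr.
  have : S u1 = t *: u1.
    by apply: (ker_eigen g'_adm g'0) => x; rewrite g'E pu1 zu1; ring.
  rewrite linearB linearZ /= Sz scalerBr !scalerA [t * _]mulrC.
  by move=> /addIr.
pose phi v := psi v / q; pose E := S y0 - t *: y0.
have SE v : S v = t *: v + phi v *: E.
  have : psi (v - phi v *: y0) = 0.
    by rewrite /psi formBr formZr /= -!/(psi _) divfK// subrr.
  move=> /ker_psi; rewrite linearB linearZ /= => /eqP.
  rewrite subr_eq => /eqP ->; rewrite /E !scalerBr !scalerA -addrA [_ * t]mulrC.
  by congr (_ + _); rewrite addrC.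
have [t0|t0] := eqVneq t 0.
  left; exists E => v; exists (phi v); rewrite {1}SE t0 scale0r add0r//.
right; split=> // v.
(* This is c = t g with S replaced by t + phi(.) E. If g(E,.) vanished, then g would too. Setting x
   = E therefore gives phi(E) = -t, that is S E = 0. *)
have C x y : t * g x y + phi x * g E y + phi y * g x E = 0.
  have := cformE g_adm x y; rewrite /cform (SE x) (SE y).
  rewrite formDl formDr !formZl !formZr /=; lra.
have [y gEy] : exists y, g E y != 0.
  apply: contrapT => /forallNP gE.
  have gE0 y : g E y = 0 by have /negP := gE y; rewrite negbK => /eqP.
  have := C a b; rewrite [g a E](alt_anti g_adm) !gE0 oppr0 !mulr0 !addr0.
  by move/eqP; rewrite mulf_eq0 (negPf t0) (negPf gab).
have phiE : phi E = - t.
  have := C E y; rewrite g_adm.1 mulr0 addr0 -mulrDl => /eqP.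
  by rewrite mulf_eq0 (negPf gEy) orbF addrC addr_eq0 => /eqP.
have SE0 : S E = 0 by rewrite SE phiE scaleNr subrr.
by rewrite {1}(SE v) linearD !linearZ /= SE0 scaler0 addr0.
Qed.

Lemma gauss_linear z w : linear (gauss z w).
Proof.
move=> a x y; rewrite /gauss !formPr /=.
rewrite !scalerDl !scalerBr !scalerA !opprD !addrA; congr (_ - _).
by rewrite -!addrA; congr (_ + _); rewrite addrC.
Qed.

(** * The tensors R^k omega in one tangent space *)

Variable omega : {biscalar V}.

(* R^k . omega at a point, up to the sign (-1)^k, as a function of the list of
   its arguments. *)
Fixpoint curv_tensor k (l : seq V) : R :=
  match k with
  | 0 => if l is [:: x; y] then omega x y else 0
  | k'.+1 => if l is z :: w :: m then derivation (gauss z w) (curv_tensor k') m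
             else 0
  end.

Lemma gaussPl a z z' w v :
  gauss (a *: z + z') w v = a *: gauss z w v + gauss z' w v.
Proof.
rewrite /gauss formPl linearP /= scalerDr scalerDl !scalerBr !scalerA.
rewrite opprD !addrA [h w v * a]mulrC; congr (_ - _).
by rewrite -!addrA; congr (_ + _); rewrite addrC.
Qed.

Lemma gauss_anti z w v : gauss z w v = - gauss w z v.
Proof. by rewrite /gauss opprB. Qed.

Lemma gaussPr a z w w' v :
  gauss z (a *: w + w') v = a *: gauss z w v + gauss z w' v.
Proof. by rewrite gauss_anti gaussPl opprD -scalerN -!gauss_anti. Qed.

(** In the first two slots by linearity of [gauss] in its parameters, in the others because a
    derivation preserves multilinearity. *)
Lemma curv_tensor_multilinear k : multilinear (curv_tensor k).
Proof.
elim: k => [|k IH] l m a x y /=.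
  case: l m => [|u [|v [|? ?]]] [|? [|? ?]] /=; rewrite ?mulr0 ?addr0//.
  - by rewrite formPl.
  - by rewrite formPr.
case: l => [|u [|v l]] /=; last by
  exact: derivation_multilinear (gauss_linear _ _) _ _ _ _ _ _.
  case: m => [|w m]; first by rewrite mulr0 addr0.
  by apply: derivation_opP => // v; exact: gaussPl.
by apply: derivation_opP => // v; exact: gaussPr.
Qed.

(** The default value on lists of the wrong length is 0, so vanishing on all lists is the same as
    vanishing of the tensor. *)
Lemma curv_tensor_size k l : size l != (k.*2 + 2)%N -> curv_tensor k l = 0.
Proof.
elim: k l => [|k IH] [|x [|y l]]//=; first by case: l.
by rewrite !eqSS => sl; apply: derivation0 => m ml; apply: IH; rewrite ml.
Qed.

Definition leading_form k l x y := curv_tensor k.+1 (x :: y :: l).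

Lemma leading_form_pack k l :
  exists G : {biscalar V}, forall x y, G x y = leading_form k l x y.
Proof.
apply: biscalar_pack => z a x y.
  exact: (@curv_tensor_multilinear k.+1 [:: z] l).
exact: (@curv_tensor_multilinear k.+1 [::] (z :: l)).
Qed.

Lemma leading_form_alt k l x : leading_form k l x x = 0.
Proof.
apply: derivation_op0; first exact: curv_tensor_multilinear.
by move=> v; rewrite /gauss subrr.
Qed.

(** By [h]-symmetry of [S], the commutator of two curvature operators is a combination of curvature
    operators with values of [s] as coefficients. *)
Lemma gauss_commutator z w x y v :
  gauss x y (gauss z w v) - gauss z w (gauss x y v) =
  (- s w x) *: gauss z y v + (s z x *: gauss w y v
    + (s w y *: gauss z x v + (- s z y) *: gauss w x v)).
Proof.
apply: h_ext => u; rewrite /gauss /s !(formBr, formZr).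
rewrite !(formDl, formBl, formNl, formZl) /=.
rewrite [h y (S w)]h_sym [h x (S w)]h_sym [h y (S z)]h_sym [h x (S z)]h_sym.
by rewrite -!S_sym; ring.
Qed.

(** Each hypothesis expresses an iterated derivation of the tensor of order [k] through the action
    of R on the leading form. Their difference is a commutator, which [gauss_commutator] turns back
    into values of that form. Only these two values of the tensor enter, so the lemma also applies
    to restricted arguments. *)
Lemma leading_form_kn k l x y z w :
  curv_tensor k.+2 [:: z, w, x, y & l] = 0 ->
  curv_tensor k.+2 [:: x, y, z, w & l] = 0 ->
  kn h (cform (leading_form k l)) z w x y = kn s (leading_form k l) z w x y.
Proof.
have half x' y' z' w' : curv_tensor k.+2 [:: z', w', x', y' & l] = 0 ->
    derivation (gauss z' w') (derivation (gauss x' y') (curv_tensor k)) l =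
    - (leading_form k l (gauss z' w' x') y' +
       leading_form k l x' (gauss z' w' y')).
  by rewrite /= => T0; apply/eqP; rewrite -addr_eq0 addrC -addrA T0.
move=> /half E1 /half E2.
have Ul := @curv_tensor_multilinear k.
have := derivation_commutator (gauss z w) (gauss x y) l Ul.
have fold z' w' : derivation (gauss z' w') (curv_tensor k) l =
    leading_form k l z' w' by [].
rewrite E1 E2 (derivation_opP l Ul (gauss_commutator z w x y)) fold.
rewrite (derivation_opP l Ul (A := gauss w y) (a := s z x) (fun=> erefl)) fold.
rewrite (derivation_opP l Ul (A := gauss z x) (a := s w y) (fun=> erefl)) fold.
rewrite (derivation_opP l Ul (A := gauss w x) (B := fun=> 0) (a := - s z y));
  last by move=> v; rewrite addr0.
rewrite fold (derivation_op0 l Ul (A := fun=> 0))// addr0.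
have [G GE] := leading_form_pack k l; rewrite -!GE.
have Ga u v : G u v = - G v u.
  have := leading_form_alt k l (u + v).
  rewrite -GE formDl !formDr !GE !leading_form_alt add0r addr0 => /eqP.
  by rewrite addr_eq0 => /eqP.
rewrite /kn /cform -!GE /gauss !(formBl, formBr, formZl, formZr) /=.
rewrite [G x (S z)]Ga [G x (S w)]Ga [G (S x) w]Ga [G (S y) w]Ga.
rewrite [h y z]h_sym [h y w]h_sym [h x z]h_sym [h x w]h_sym.
lra.
Qed.

(** * Descent in the power of the curvature *)

Section Descent.
Variable k : nat.
Hypothesis U0 : forall l, curv_tensor k.+2 l = 0.

Lemma leading_form_admissible l (G : V -> V -> R) :
  (forall x y, G x y = leading_form k l x y) -> admissible G.
Proof.
move=> GE; split=> [x|x y z w]; first by rewrite GE leading_form_alt.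
by rewrite /kn /cform !GE; exact: leading_form_kn.
Qed.

Lemma leading_form_gauss l z w x y :
  leading_form k l (gauss z w x) y + leading_form k l x (gauss z w y) =
  - derivation (gauss z w) (fun m => leading_form k m x y) l.
Proof.
have /= U0l := U0 [:: z, w, x, y & l].
by apply/eqP; rewrite -addr_eq0 -addrA U0l.
Qed.

(** Up to sign, R(z,w).g is the derivative by R(z,w) of the leading form in its parameter list [l].
    The admissibility identity is linear in the form and holds for every list, so it survives this
    derivation. *)
Lemma gauss_admissible l z w : exists2 g' : {biscalar V}, admissible g' &
  forall x y, g' x y =
    leading_form k l (gauss z w x) y + leading_form k l x (gauss z w y).
Proof.
have [G GE] := leading_form_pack k l.
have [||G' G'E] := @biscalar_pack _ _ (fun x y =>
    G (gauss z w x) y + G x (gauss z w y)).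
- by move=> x a y y' /=; rewrite gauss_linear !formPr /=; ring.
- by move=> y a x x' /=; rewrite gauss_linear !formPl /=; ring.
exists G' => [|x y]; last by rewrite G'E !GE.
have {}G'E x y : G' x y =
    - derivation (gauss z w) (fun m => leading_form k m x y) l.
  by rewrite G'E !GE leading_form_gauss.
split=> [x|x y u v].
  by rewrite G'E derivation0 ?oppr0// => m _; exact: leading_form_alt.
have : derivation (gauss z w) (fun m => kn h (cform (leading_form k m)) u v x y
    + - kn s (leading_form k m) u v x y) l = 0.
  by apply: derivation0 => m _; rewrite leading_form_kn ?subrr.
rewrite /kn /cform !(derivationD, derivationN, derivationZ) !G'E; lra.
Qed.

Lemma descent_step :
  [\/ forall l, curv_tensor k.+1 l = 0, line_image |
       t != 0 /\ forall v, S (S v) = t *: S v].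
Proof.
have [/Or31//|/existsNP[l /eqP Ul]] :=
  pselect (forall l, curv_tensor k.+1 l = 0).
(* Lists with fewer than two entries give the default value 0. *)
case: l Ul => [|x [|y l]]; rewrite ?eqxx// => Ul.
have [G GE] := leading_form_pack k l.
have [|z w||H|H] := @admissible_structure G x y; last 2 first.
- exact: Or32.
- exact: Or33.
- exact: leading_form_admissible GE.
- have [g' g'a g'E] := gauss_admissible l z w; exists g' => // u v.
  by rewrite g'E !GE.
- by rewrite GE.
Qed.

End Descent.

(** On arguments in the image of S, both sides of [leading_form_kn] are multiples of s (.) G(S.,S.):
    by 2 t^2 on the left and t^2 on the right. So that product vanishes, and its trace is (3 t - t -
    t) G(S.,S.). *)
Lemma idempotent_descent_step k x y l : t != 0 ->
  (forall v, S (S v) = t *: S v) ->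
  (forall x y l, curv_tensor k.+2 [:: S x, S y & l] = 0) ->
  curv_tensor k.+1 [:: S x, S y & l] = 0.
Proof.
move=> t_neq0 SS U0; have [G GE] := leading_form_pack k l.
rewrite -[LHS]/(leading_form k l (S x) (S y)).
have Gaa v : G v v = 0 by rewrite GE leading_form_alt.
have Ga u v : G (S u) (S v) = - G (S v) (S u).
  have := Gaa (S u + S v); rewrite formDl !formDr !Gaa add0r addr0.
  by move/eqP; rewrite addr_eq0 => /eqP.
pose z := x.
have E w u : kn s (fun a b => G (S a) (S b)) z w u y = 0.
  have SSS v : S (t *: S v) = t *: (t *: S v) by rewrite linearZ /= SS.
  have := @leading_form_kn k l (S u) (S y) (S z) (S w) (U0 _ _ _) (U0 _ _ _).
  rewrite /kn /cform -!GE /s -!S_sym !SS !SSS !(formZl, formZr) /= => E.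
  have t2 : t * t != 0 by rewrite mulf_neq0.
  by apply: (mulfI t2); rewrite mulr0; lra.
have [F FE] : exists F : {scalar V}, forall v, F v = G (S z) (S v).
  by apply: scalar_pack => a u v; rewrite linearP formPr.
have [F' F'E] : exists F : {scalar V}, forall v, F v = G (S y) (S v).
  by apply: scalar_pack => a u v; rewrite linearP formPr.
have : contract (fun w u => G (S z) (S y) * s w u + h (S z) u * F' w +
     (-1 * (h (S y) w * F u) + s z y * G (S w) (S u))) = 0.
  rewrite /contract big1// => i _.
  rewrite -[RHS](mulr0 (sgn i)) -(E (e i) (e i)); congr (_ * _).
  by rewrite /kn FE F'E [G (S (e i)) (S y)]Ga [s (e i) y]s_sym /s; ring.
rewrite !contractD !contractZ contract_hr.
rewrite (_ : contract (fun w u => h (S z) u * F' w) = F' (S z)); last first.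
  by rewrite -(contract_hr F' (S z)); apply: eq_bigr.
rewrite (_ : contract (fun w u => G (S w) (S u)) = 0); last first.
  by rewrite /contract big1// => i _; rewrite Gaa mulr0.
rewrite (_ : contract s = 3 * t); last by rewrite /t; field.
rewrite FE F'E !SS !(formZl, formZr) /= [G (S y) (S z)]Ga => E'.
by rewrite -GE -/z; apply: (mulfI t_neq0); rewrite mulr0; lra.
Qed.


(** * The end of the descent: first power of R on the symplectic form *)

Hypothesis omega_alt : forall x, omega x x = 0.
Hypothesis omega_nondeg : forall u, (forall v, omega u v = 0) -> u = 0.

Lemma S_eq0 : (forall x, h (S x) x = 0) -> forall x, S x = 0.
Proof.
move=> S0 x; apply: h_nondeg => y; have := S0 (x + y).
rewrite linearD formDl !formDr /= !S0 add0r addr0 [h (S y) x]S_sym h_sym.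
lra.
Qed.

Lemma omega_anti x y : omega x y = - omega y x.
Proof.
have := omega_alt (x + y); rewrite formDl !formDr !omega_alt add0r addr0.
by move/eqP; rewrite addr_eq0 => /eqP.
Qed.

(** Tracing over the two middle arguments gives 2 omega(Sx,v) = c h(x,v). If c = 0, nondegeneracy of
    omega gives S = 0; otherwise v = Sx gives h(Sx,x) = 0. *)
Lemma curv_tensor1_eq0 : (forall l, curv_tensor 1 l = 0) -> forall x, S x = 0.
Proof.
move=> U0; pose c := contract (fun y u => omega u (S y)).
have E x v : 2 * omega (S x) v = c * h x v.
  pose F := [the {scalar V} of omega v].
  have [F' F'E] : exists F' : {scalar V}, forall y, F' y = omega v (S y).
    by apply: scalar_pack => a u w; rewrite linearP formPr.
  have : contract (fun y u => omega (S x) v * h y u + h x u * F' y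
      + (-1 * (h v y * [the {scalar V} of omega (S x)] u)
      + -1 * h x v * omega u (S y))) = 0.
    rewrite /contract big1// => i _; rewrite -[RHS](mulr0 (sgn i)).
    rewrite -(U0 [:: x; e i; e i; v]) /= /gauss; congr (_ * _).
    rewrite F'E !(formBl, formBr, formZl, formZr) /= addr0.
    rewrite [omega v _]omega_anti [h v (e i)]h_sym.
    by rewrite [omega (e i) (S x)]omega_anti; ring.
  rewrite !contractD !contractZ contract_hr contract_h -/c.
  rewrite (_ : contract (fun y u => h x u * F' y) = F' x); last first.
    by rewrite -(contract_hr F' x); apply: eq_bigr.
  by rewrite F'E /= [omega v _]omega_anti; lra.
have [c0|c0] := eqVneq c 0.
  by move=> x; apply: omega_nondeg => v; have := E x v; rewrite c0 mul0r; lra.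
apply: S_eq0 => x; have := E x (S x); rewrite omega_alt mulr0 => /esym/eqP.
by rewrite mulf_eq0 (negPf c0) S_sym => /eqP.
Qed.

(** The same trace, divided by t, with tr S = 3 t in place of tr h = 4. It leaves an extra term
    omega(Sx,Sv), which is found by substituting Sv for v. *)
Lemma curv_tensor1_idempotent : t != 0 -> (forall v, S (S v) = t *: S v) ->
  (forall x y l, curv_tensor 1 [:: S x, S y & l] = 0) -> forall x, S x = 0.
Proof.
move=> t0 SS U0; pose c := contract (fun y u => omega u (S y)).
have E x v : 2 * t * omega (S x) v - omega (S x) (S v) = c * s x v.
  have [F' F'E] : exists F' : {scalar V}, forall y, F' y = omega v (S y).
    by apply: scalar_pack => a u w; rewrite linearP formPr.
  have : contract (fun y u => omega (S x) v * s y u + h (S x) u * F' y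
      + (-1 * (h (S v) y * [the {scalar V} of omega (S x)] u)
      + -1 * s x v * omega u (S y))) = 0.
    rewrite /contract big1// => i _; rewrite -[RHS](mulr0 (sgn i)).
    congr (_ * _); apply: (mulfI t0); rewrite mulr0.
    rewrite -(U0 x (e i) [:: e i; v]) /= /gauss !SS.
    rewrite F'E !(formBl, formBr, formZl, formZr) /= addr0.
    rewrite [omega v _]omega_anti [omega (e i) (S x)]omega_anti.
    by rewrite -[h (S v) _]/(s v _) [s v _]s_sym /s; ring.
  rewrite !contractD !contractZ contract_hr -/c.
  rewrite (_ : contract (fun y u => h (S x) u * F' y) = F' (S x)); last first.
    by rewrite -(contract_hr F' (S x)); apply: eq_bigr.
  rewrite (_ : contract s = 3 * t); last by rewrite /t; field.
  by rewrite F'E /= SS formZr /= [omega v _]omega_anti; lra.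
have E' x v : omega (S x) (S v) = c * s x v.
  have := E x (S v); rewrite SS formZr /= /s -S_sym SS formZl /= => E2.
  by apply: (mulfI t0); lra.
have [c0|c0] := eqVneq c 0.
  move=> x; apply: omega_nondeg => v; apply: (mulfI t0).
  by have := E x v; rewrite E' c0 !mul0r mulr0; lra.
apply: S_eq0 => x; have := E' x x; rewrite omega_alt => /esym/eqP.
by rewrite mulf_eq0 (negPf c0) => /eqP.
Qed.

Theorem curv_tensor_line_image k :
  (forall l, curv_tensor k.+1 l = 0) -> line_image.
Proof.
elim: k => [/curv_tensor1_eq0/line_image0//|k IH U0].
have [/IH//|//|[t0 SS]] := descent_step U0.
apply: line_image0; apply: curv_tensor1_idempotent => // x y l.
(* A second induction starts from this weaker vanishing, with the first two arguments in the image
   of S; it passes down to order 1. *)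
have : forall x y l, curv_tensor k.+2 [:: S x, S y & l] = 0 by [].
elim: k {U0 IH} => [|k IH] U0; first exact: idempotent_descent_step.
by apply: IH => *; exact: idempotent_descent_step.
Qed.


End LorentzAlgebra.

(** * Closure properties of smooth functions on open sets *)

Section SmoothOn.
Context {R : realType} {V : normedModType R}.
Implicit Types (U : set V).

Lemma Ck_cst {W : normedModType R} k U (c : W) : Ck k U (cst c).
Proof.
elim: k c => [|k IH] c /=; first by move=> x _; exact: cst_continuous.
split=> [x _|v]; first exact: differentiable_cst.
rewrite (_ : 'D_v (cst c) = cst 0); first exact: IH.
by apply/funext => x; rewrite derive_cst.
Qed.

Lemma smooth_on_lin (W : normedModType R) U (a : R) (f g : V -> W) : open U ->
  smooth_on U f -> smooth_on U g -> smooth_on U (fun x => a *: f x + g x).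
Proof. by move=> oU sf sg k; exact: Ck_lin (sf k) (sg k). Qed.

Lemma smooth_onM U (f g : V -> R) : open U ->
  smooth_on U f -> smooth_on U g -> smooth_on U (fun x => f x * g x).
Proof. by move=> oU sf sg k; exact: Ck_mul (sf k) (sg k). Qed.

Lemma smooth_on_derive (W : normedModType R) U (f : V -> W) v :
  smooth_on U f -> smooth_on U ('D_v f).
Proof. by move=> sf k; have [_ /(_ v)] := sf k.+1. Qed.

Lemma smooth_on_ext (W : normedModType R) U (f g : V -> W) : open U ->
  (forall x, U x -> f x = g x) -> smooth_on U f -> smooth_on U g.
Proof. by move=> oU fg sf k; exact: Ck_ext (sf k). Qed.

Lemma smooth_on_cst (W : normedModType R) U (c : W) : smooth_on U (fun=> c).
Proof. by move=> k; exact: Ck_cst. Qed.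

Lemma smooth_on_sum U I (r : seq I) (P : pred I) (F : I -> V -> R) : open U ->
  (forall i, smooth_on U (F i)) ->
  smooth_on U (fun x => \sum_(i <- r | P i) F i x).
Proof.
move=> oU sF; elim: r => [|i r IH].
  apply: (smooth_on_ext (f := fun=> 0)) => //; last exact: smooth_on_cst.
  by move=> x _; rewrite big_nil.
apply: smooth_on_ext (smooth_on_lin (if P i then 1 else 0) oU (sF i) IH) => //.
by move=> x _; rewrite big_cons; case: (P i); rewrite ?scale1r ?scale0r ?add0r.
Qed.

Lemma smooth_on_prod U I (r : seq I) (F : I -> V -> R) : open U ->
  (forall i, smooth_on U (F i)) -> smooth_on U (fun x => \prod_(i <- r) F i x).
Proof.
move=> oU sF; elim: r => [|i r IH].
  apply: (smooth_on_ext (f := fun=> (1 : R))) => //; last exact: smooth_on_cst.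
  by move=> x _; rewrite big_nil.
apply: smooth_on_ext (smooth_onM oU (sF i) IH) => // x _.
by rewrite big_cons.
Qed.

Lemma smooth_on_det U n (A : V -> 'M[R]_n) : open U ->
  (forall i j, smooth_on U (fun x => A x i j)) ->
  smooth_on U (fun x => \det (A x)).
Proof.
move=> oU sA; apply: smooth_on_sum => // s.
by apply: smooth_onM => //; [exact: smooth_on_cst|exact: smooth_on_prod].
Qed.

(** Induction on the order of differentiability: the derivative of 1/f is -(1/f)^2 f', which
    involves 1/f only at the order already reached. *)
Lemma smooth_onV U (f : V -> R) : open U -> (forall x, U x -> f x != 0) ->
  smooth_on U f -> smooth_on U (fun x => (f x)^-1).
Proof.
move=> oU f0 sf; elim=> [|k IH] /=.
  by move=> x Ux; apply: continuousV; [exact: f0|exact: (sf 0)].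
have [df _] := sf 1%N.
split=> [x Ux|v]; first by apply: differentiableV; [exact: df|exact: f0].
have s2 : Ck k U ((fun x => (f x)^-1) * (fun x => (f x)^-1)) by exact: Ck_mul.
have := Ck_lin (-1) oU (Ck_mul oU s2 (smooth_on_derive v sf k)) (Ck_cst k U 0).
apply: Ck_ext => // x Ux; rewrite deriveV; [|exact: f0|exact/diff_derivable/df].
by rewrite !fctE scaleN1r addr0 -exprVn expr2 scaleNr.
Qed.

Lemma derive_coord n (f : V -> 'rV[R]_n) x v j : derivable f x v ->
  'D_v (fun y => f y 0 j) x = 'D_v f x 0 j.
Proof. by move=> df; rewrite derive_mx// mxE. Qed.

Lemma smooth_on_coord U n (f : V -> 'rV[R]_n) j : open U -> smooth_on U f ->
  smooth_on U (fun x => f x 0 j).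
Proof.
move=> oU sf k; elim: k f sf => [|k IH] f sf /=.
  move=> x Ux; apply: (@continuous_comp _ _ _ f (fun M : 'rV[R]_n => M 0 j)).
    exact: (sf 0).
  exact: coord_continuous.
have [df _] := sf 1%N; split=> [x Ux|v].
  apply: (@differentiable_comp _ _ _ _ f (fun M : 'rV[R]_n => M 0 j)).
    exact: df.
  exact: differentiable_coord.
apply: Ck_ext (IH _ (smooth_on_derive v sf)) => // x Ux.
by rewrite derive_coord//; exact/diff_derivable/df.
Qed.

End SmoothOn.

(** * Coordinate frames and extension of tangent vectors to vector fields *)

Section Frames.
Context {R : realType} {n : nat} {M : manifold R n}.
Implicit Types (c : chart R n M) (q : M) (U : set M) (f g : M -> R).

(** The coordinate vector at [q]; the value 0 on functions not smooth near [q] is forced by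
    [deriv_junk]. *)
Definition partial_fun c q (i : 'I_n) g : R :=
  if `[< smooth_near q g >]
  then 'D_('e_i) (g \o chart_inv c) (chart_map c q) else 0.

Lemma chart_mapKin c q : chart_dom c q -> chart_inv c (chart_map c q) = q.
Proof. by move=> cq; apply: chart_mapK; rewrite inE. Qed.

Lemma chart_near c q (P : M -> Prop) : chart_dom c q ->
  (\forall r \near q, P r) -> \forall x \near chart_map c q, P (chart_inv c x).
Proof.
move=> cq Pq.
have cc : {for chart_map c q, continuous (chart_inv c)}.
  by apply: chart_inv_continuous; rewrite inE; exists q.
have := cc P; rewrite /continuous_at chart_mapKin//; exact.
Qed.

Lemma smooth_near_chart c q g : atlas c -> chart_dom c q -> smooth_near q g ->
  differentiable (g \o chart_inv c) (chart_map c q).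
Proof.
move=> ac cq [U [oU Uq sg]]; have [d _] := sg c ac 1%N.
by apply: d; exists q.
Qed.

Lemma partial_derivation c q i : atlas c -> chart_dom c q ->
  partial_fun c q i \in derivations q.
Proof.
move=> ac cq; have dE h : smooth_near q h ->
    derivable (h \o chart_inv c) (chart_map c q) 'e_i.
  by move=> sh; apply: diff_derivable; exact: smooth_near_chart.
rewrite inE /partial_fun /=; split=> [f g sf fg|a f g sf sg|f g sf sg|f sf].
- have sg := smooth_near_ext fg sf; rewrite !asboolT//.
  by apply: near_eq_derive; exact: (chart_near (P := fun r => f r = g r)).
- have sfg := smooth_near_lin a sf sg; rewrite !asboolT//.
  have vf := dE _ sf; have vg := dE _ sg.
  rewrite -[in LHS]/(a *: (f \o chart_inv c) + (g \o chart_inv c)).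
  by rewrite deriveD ?deriveZ//; exact: derivableZ.
- have sfg := smooth_nearM sf sg; rewrite !asboolT//.
  have vf := dE _ sf; have vg := dE _ sg.
  rewrite -[in LHS]/((f \o chart_inv c) * (g \o chart_inv c)) deriveM//=.
  by rewrite chart_mapKin// /GRing.scale /= [g q * _]mulrC.
- by rewrite asboolF.
Qed.

Lemma coord_smooth_near c q j : atlas c -> chart_dom c q ->
  smooth_near q (fun r => chart_map c r 0 j).
Proof.
move=> ac cq; exists (chart_dom c); split=> //; first exact: chart_dom_open.
move=> c' ac'; apply: (smooth_on_coord (f := transition c' c)).
  by apply: chart_img_openI; exact: chart_dom_open.
rewrite setIC; exact: (atlas_compatible ac' ac).1.
Qed.

Lemma partial_coord c q i j : atlas c -> chart_dom c q ->
  partial_fun c q i (fun r => chart_map c r 0 j) = (i == j)%:R.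
Proof.
move=> ac cq; rewrite /partial_fun asboolT; last exact: coord_smooth_near.
transitivity ('D_('e_i) (fun x : 'rV[R]_n => x 0 j) (chart_map c q)).
  apply: near_eq_derive; apply: (open_near (U := chart_map c @` chart_dom c)).
  - exact: chart_img_open.
  - by exists q.
  - by move=> _ [r cr <-] /=; rewrite chart_mapKin.
rewrite (derive_coord (f := id)); last exact: derivable_id.
by rewrite derive_id mxE eqxx eq_sym.
Qed.

Variables (f xi : M -> 'rV[R]_n.+1).
Hypothesis f_immersion : immersion f.
Hypothesis xi_transversal : transversal_field f xi.

Lemma dirderP (p : M) a (v w : tangent p) (F : M -> 'rV[R]_n.+1) :
  dirder (a *: v + w) F = a *: dirder v F + dirder w F.
Proof. by apply/rowP => i; rewrite !mxE. Qed.

Lemma dirder0 (p : M) (F : M -> 'rV[R]_n.+1) : dirder (0 : tangent p) F = 0.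
Proof. by apply/rowP => i; rewrite !mxE. Qed.

Lemma transversal_inj (p : M) (v v' : tangent p) a a' :
  dirder v f + a *: xi p = dirder v' f + a' *: xi p -> v = v' /\ a = a'.
Proof.
move=> E; have [_ /(_ (-1 *: v' + v) (a - a'))] := xi_transversal.2 p.
have -> : dirder (-1 *: v' + v) f + (a - a') *: xi p =
    (dirder v f + a *: xi p) - (dirder v' f + a' *: xi p).
  by rewrite dirderP; apply/rowP => i; rewrite !mxE; ring.
rewrite E subrr => /(_ erefl) [vv' aa']; split; last exact: subr0_eq.
apply: (f_immersion.2 p); move: vv'; rewrite dirderP scaleN1r addrC.
exact: subr0_eq.
Qed.

Lemma tangent_sum (p : M) I (r : seq I) (F : I -> tangent p) g :
  (\sum_(i <- r) F i : tangent p) g = \sum_(i <- r) F i g.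
Proof. exact: (big_morph (fun v : tangent p => v g)). Qed.

Lemma smooth_fun_coord (F : M -> 'rV[R]_n.+1) a U :
  open U -> smooth_fun setT F -> smooth_fun U (fun q => F q 0 a).
Proof.
move=> oU /(smooth_funS (U' := U) (subsetT _)) sF c ac.
by apply: smooth_on_coord (sF c ac); exact: chart_img_openI.
Qed.

Definition frame_mx c (x : 'rV[R]_n) : 'M[R]_n.+1 :=
  \matrix_(i, a) if unlift ord0 i is Some j
    then 'D_('e_j) (fun y => f (chart_inv c y) 0 a) x
    else xi (chart_inv c x) 0 a.

(** A relation among the rows says f_* v + u_0 xi = 0 for a combination v of coordinate vectors.
    Transversality and immersion give v = 0 and u_0 = 0, and v applied to the coordinate functions
    returns the other coefficients. *)
Lemma frame_mx_unit c q : atlas c -> chart_dom c q ->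
  frame_mx c (chart_map c q) \in unitmx.
Proof.
move=> ac cq; rewrite -row_free_unit -kermx_eq0.
apply/rowV0P => u /sub_kermxP uA.
pose d j := Tangent (partial_derivation j ac cq).
pose v := \sum_j u 0 (lift ord0 j) *: d j.
have vE g : v g = \sum_j u 0 (lift ord0 j) * partial_fun c q j g.
  by rewrite tangent_sum.
have E : dirder v f + u 0 ord0 *: xi q = 0.
  rewrite -uA; apply/rowP => a; rewrite !mxE vE big_ord_recl addrC.
  rewrite mxE unlift_none chart_mapKin//; congr (_ + _).
  apply: eq_bigr => j _; rewrite mxE liftK /partial_fun asboolT//.
  exists setT; split=> //; first exact: openT.
  by apply: smooth_fun_coord; [exact: openT|exact: f_immersion.1].
have [v0 u0] : v = 0 /\ u 0 ord0 = 0.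
  by apply: transversal_inj; rewrite E dirder0 scale0r addr0.
apply/rowP => i; rewrite mxE; case: (unliftP ord0 i) => [j|] ->//.
transitivity (v (fun r => chart_map c r 0 j)); last by rewrite v0.
rewrite vE (bigD1 j)//= partial_coord// eqxx mulr1 big1 ?addr0// => l lj.
by rewrite partial_coord// (negPf lj) mulr0.
Qed.


Lemma tangential_part_ex (w : 'rV[R]_n.+1) q :
  exists v : tangent q, exists a, w = dirder v f + a *: xi q.
Proof. exact: (xi_transversal.2 q).1 w. Qed.

Definition tangential_part w q : tangent q :=
  projT1 (cid (tangential_part_ex w q)).

(* In a chart, the coordinates of the tangential part in the frame
   (xi, d_1, ..., d_n) are given by Cramer's rule. *)
Lemma tangential_part_smooth w U g : open U -> smooth_fun U g ->
  smooth_fun U (fun q => tangential_part w q g).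
Proof.
move=> oU sg c ac; set O := chart_map c @` (U `&` chart_dom c).
have oO : open O by exact: chart_img_openI.
have sA i j : smooth_on O (fun x => frame_mx c x i j).
  case: (unliftP ord0 i) => [k|] iE.
    pose fj := (fun q => f q 0 j) \o chart_inv c.
    apply: (smooth_on_ext (f := 'D_('e_k) fj)) => //.
      by move=> x _; rewrite mxE iE liftK.
    apply: smooth_on_derive; apply: smooth_fun_coord => //.
    exact: f_immersion.1.
  apply: (smooth_on_ext (f := (fun q => xi q 0 j) \o chart_inv c)) => //.
    by move=> x _; rewrite mxE iE unlift_none.
  by apply: smooth_fun_coord => //; exact: xi_transversal.1.
have uA x : O x -> frame_mx c x \in unitmx.
  by move=> [q [_ cq] <-]; exact: frame_mx_unit.
have sAV i j : smooth_on O (fun x => invmx (frame_mx c x) i j).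
  apply: (smooth_on_ext (f := fun x => (\det (frame_mx c x))^-1 *
      cofactor (frame_mx c x) j i)) => //.
    by move=> x Ox; rewrite /invmx uA// !mxE.
  apply: smooth_onM => //.
    apply: smooth_onV => //; last exact: smooth_on_det.
    by move=> x /uA; rewrite unitmxE unitfE.
  apply: smooth_onM => //; first exact: smooth_on_cst.
  apply: smooth_on_det => // i' j'.
  by apply: smooth_on_ext (sA (lift j i') (lift i j')) => // x _; rewrite !mxE.
pose F x := \sum_j (w *m invmx (frame_mx c x)) 0 (lift ord0 j) *
                   'D_('e_j) (g \o chart_inv c) x.
apply: (smooth_on_ext (f := F)) => //; last first.
  apply: smooth_on_sum => // j; apply: smooth_onM => //.
    apply: (smooth_on_ext (f := fun x =>
        \sum_a w 0 a * invmx (frame_mx c x) a (lift ord0 j))) => //.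
      by move=> x _; rewrite mxE.
    apply: smooth_on_sum => // a; apply: smooth_onM => //.
    exact: smooth_on_cst.
  by apply: smooth_on_derive; exact: sg.
move=> _ [q [Uq cq] <-] /=; rewrite chart_mapKin//.
have wE := mulmxKV (frame_mx_unit ac cq) w; rewrite /F.
move: (w *m _) wE => u uE.
pose d j := Tangent (partial_derivation j ac cq).
pose v := \sum_j u 0 (lift ord0 j) *: d j.
have vE h : v h = \sum_j u 0 (lift ord0 j) * partial_fun c q j h.
  by rewrite tangent_sum.
have -> : tangential_part w q = v.
  rewrite /tangential_part; case: cid => u' /= [a E].
  apply: (transversal_inj (a := a) (a' := u 0 ord0) _).1.
  rewrite -E -uE.
  apply/rowP => b; rewrite !mxE big_ord_recl addrC vE.
  rewrite [frame_mx _ _ _ _]mxE unlift_none chart_mapKin//; congr (_ + _).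
  apply: eq_bigr => j _; rewrite [frame_mx _ _ _ _]mxE liftK.
  rewrite /partial_fun asboolT//.
  exists setT; split=> //; first exact: openT.
  by apply: smooth_fun_coord; [exact: openT|exact: f_immersion.1].
rewrite vE; apply: eq_bigr => j _; rewrite /partial_fun asboolT//.
by exists U.
Qed.


(* Tangential parts of constant ambient vectors are global vector fields, so no
   bump functions are needed. *)
Lemma vfield_through p (v : tangent p) : exists X : vfield M, X p = v.
Proof.
exists (VField (tangential_part_smooth (dirder v f))) => /=.
rewrite /tangential_part; case: cid => u' /= [a E].
apply/esym; apply: (transversal_inj (a := 0) (a' := a) _).1.
by rewrite scale0r addr0.
Qed.

End Frames.

(** * The Gauss and Ricci equations *)

Section GaussRicci.
Context {R : realType} {n : nat} {M : manifold R n}.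
Variables (f xi : M -> 'rV[R]_n.+1).
Hypothesis f_immersion : immersion f.
Hypothesis xi_transversal : transversal_field f xi.
Variables (nabla : vfield M -> vfield M -> vfield M) (h : bilinear_field M).
Variables (S : endo_field M) (tau : form1 M).
Hypothesis induced : induced_by f xi nabla h S tau.
Implicit Types (X Y Z : vfield M) (p : M).

Let F a p := f p 0 a.
Let G a p := xi p 0 a.

Lemma smooth_setT_near p (g : M -> R) : smooth_fun setT g -> smooth_near p g.
Proof. by move=> sg; exists setT; split=> //; exact: openT. Qed.

Lemma f_near a p : smooth_near p (F a).
Proof.
apply: smooth_setT_near; apply: smooth_fun_coord; first exact: openT.
exact: f_immersion.1.
Qed.

Lemma xi_near a p : smooth_near p (G a).
Proof.
apply: smooth_setT_near; apply: smooth_fun_coord; first exact: openT.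
exact: xi_transversal.1.
Qed.

Lemma h_near X Y p : smooth_near p (fun q => h q (X q) (Y q)).
Proof. by apply: smooth_setT_near; exact: bilinear_smooth. Qed.

Lemma tau_near X p : smooth_near p (fun q => tau q (X q)).
Proof. by apply: smooth_setT_near; exact: form1_smooth. Qed.

Lemma gauss_formula X Y p a :
  X p (fun q => Y q (F a)) = nabla X Y p (F a) + h p (X p) (Y p) * G a p.
Proof.
have /rowP/(_ a) := induced.1 X Y p; rewrite !mxE => <-.
by congr (X p _); apply/funext => q; rewrite mxE.
Qed.

Lemma weingarten_formula X p a :
  X p (G a) = - (S p (X p)) (F a) + tau p (X p) * G a p.
Proof. by have /rowP/(_ a) := induced.2 X p; rewrite !mxE. Qed.

Lemma bracketE X Y p g : smooth_near p g ->
  bracket X Y p g = X p (fun q => Y q g) - Y p (fun q => X q g).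
Proof. by move=> sg; rewrite /= /bracket_fun asboolT. Qed.

Lemma derivD p (v : tangent p) g g' : smooth_near p g -> smooth_near p g' ->
  v (fun q => g q + g' q) = v g + v g'.
Proof.
move=> sg sg'; have := deriv_lin (tangentP v) 1 sg sg'.
by rewrite mul1r scale1r.
Qed.

Lemma derivM p (v : tangent p) g g' : smooth_near p g -> smooth_near p g' ->
  v (fun q => g q * g' q) = g p * v g' + v g * g' p.
Proof. by move=> sg sg'; exact: (deriv_leibniz (tangentP v)). Qed.

Lemma transversal0 p (v : tangent p) b :
  (forall a, v (F a) + b * G a p = 0) -> v = 0 /\ b = 0.
Proof.
move=> E; apply: (transversal_inj f_immersion xi_transversal).
by apply/rowP => a; rewrite !mxE mul0r addr0 E.
Qed.

(** Normal part of the Gauss formula antisymmetrised in X and Y; the tangential part says that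
    [nabla] is torsion-free. *)
Lemma h_symmetric p (u v : tangent p) : h p u v = h p v u.
Proof.
have [X <-] := vfield_through f_immersion xi_transversal u.
have [Y <-] := vfield_through f_immersion xi_transversal v.
apply/eqP; rewrite -subr_eq0; apply/eqP.
apply: (transversal0 (v := nabla X Y p - nabla Y X p - bracket X Y p) _).2 => a.
rewrite -[(_ - _ - _ : tangent p) _]/
  (nabla X Y p (F a) - nabla Y X p (F a) - bracket X Y p (F a)).
rewrite bracketE; last exact: f_near.
by rewrite !gauss_formula; ring.
Qed.

Lemma second_derivative X Y Z p a :
  X p (fun q => Y q (fun r => Z r (F a))) =
  nabla X (nabla Y Z) p (F a) - h p (Y p) (Z p) * (S p (X p)) (F a)
  + (h p (X p) (nabla Y Z p) + X p (fun q => h q (Y q) (Z q))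
     + h p (Y p) (Z p) * tau p (X p)) * G a p.
Proof.
transitivity (X p (fun q => nabla Y Z q (F a) + h q (Y q) (Z q) * G a q)).
  by congr (X p _); apply/funext => q; rewrite gauss_formula.
have sh := h_near Y Z p; have sG := xi_near a p.
rewrite derivD; [|exact/vfield_smooth_near/f_near|exact: smooth_nearM].
by rewrite derivM// gauss_formula weingarten_formula; ring.
Qed.

Theorem gauss_equation X Y Z p :
  curvature nabla X Y Z p =
  h p (Y p) (Z p) *: S p (X p) - h p (X p) (Z p) *: S p (Y p).
Proof.
apply/eqP; rewrite -subr_eq0; apply/eqP.
(* The [xi]-coefficient of the second derivative. Comparing XY - YX with [X,Y] on the components of
   f_* Z, the tangential part is the Gauss equation and the normal part, in [b], is the Codazzi
   equation for h. *)
pose b X Y := h p (X p) (nabla Y Z p) + X p (fun q => h q (Y q) (Z q))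
     + h p (Y p) (Z p) * tau p (X p).
apply: (transversal0 (b := b X Y - b Y X - h p (bracket X Y p) (Z p)) _).1 => a.
set u := (X in tangent_fun X).
have -> : u (F a) = nabla X (nabla Y Z) p (F a) - nabla Y (nabla X Z) p (F a)
    - nabla (bracket X Y) Z p (F a)
    - (h p (Y p) (Z p) * S p (X p) (F a) - h p (X p) (Z p) * S p (Y p) (F a)).
  by [].
have sZ : smooth_near p (fun q => Z q (F a)) by exact/vfield_smooth_near/f_near.
have := bracketE X Y sZ.
rewrite !second_derivative gauss_formula -/(b X Y) -/(b Y X); lra.
Qed.

Definition endo_vfield Y : vfield M := VField (endo_smooth S Y).

Lemma second_derivative_xi X Y p a :
  X p (fun q => Y q (G a)) =
  - nabla X (endo_vfield Y) p (F a) - tau p (Y p) * S p (X p) (F a)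
  + (- h p (X p) (S p (Y p)) + X p (fun q => tau q (Y q))
     + tau p (Y p) * tau p (X p)) * G a p.
Proof.
transitivity (X p (fun q => -1 * endo_vfield Y q (F a) + tau q (Y q) * G a q)).
  by congr (X p _); apply/funext => q; rewrite weingarten_formula mulN1r.
have st := tau_near Y p; have sG := xi_near a p.
have sF : smooth_near p (fun q => endo_vfield Y q (F a)).
  exact/vfield_smooth_near/f_near.
have := deriv_lin (tangentP (X p)) (-1) sF (smooth_nearM st sG).
rewrite -[X p (_ + _)]/(X p (fun q => _ + _)) => ->.
rewrite -[X p (_ * _)]/(X p (fun q => _ * _)).
by rewrite derivM// gauss_formula weingarten_formula /=; ring.
Qed.

(** The Ricci equation: comparing XY - YX with [X,Y] on the components of [xi], the normal part
    equates h(X,SY) - h(SX,Y) with dtau(X,Y). *)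
Lemma shape_symmetric p (u v : tangent p) : closed1 tau ->
  h p (S p u) v = h p u (S p v).
Proof.
move=> dtau0.
have [X <-] := vfield_through f_immersion xi_transversal u.
have [Y <-] := vfield_through f_immersion xi_transversal v.
have dt := dtau0 X Y p.
apply/eqP; rewrite -subr_eq0; apply/eqP.
apply: (transversal0 (v := nabla Y (endo_vfield X) p - nabla X (endo_vfield Y) p
  + tau p (X p) *: S p (Y p) - tau p (Y p) *: S p (X p)
  + S p (bracket X Y p)) _).2 => a.
set u' := (X in tangent_fun X).
have -> : u' (F a) = nabla Y (endo_vfield X) p (F a)
    - nabla X (endo_vfield Y) p (F a)
    + tau p (X p) * S p (Y p) (F a) - tau p (Y p) * S p (X p) (F a)
    + S p (bracket X Y p) (F a) by [].
have := bracketE X Y (xi_near a p).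
rewrite !second_derivative_xi weingarten_formula.
rewrite [h p (S p (X p)) (Y p)]h_symmetric.
have -> : tau p (bracket X Y p) =
  X p (fun q => tau q (Y q)) - Y p (fun q => tau q (X q)) by lra.
lra.
Qed.

End GaussRicci.

(** * Powers of R as algebraic tensors at a point *)

Section CurvaturePowers.
Context {R : realType} {n : nat} {M : manifold R n}.
Variables (nabla : vfield M -> vfield M -> vfield M) (h : bilinear_field M).
Variables (S : endo_field M) (p : M).
Hypothesis gauss_eq : forall X Y Z : vfield M,
  curvature nabla X Y Z p = gauss (h p) (S p) (X p) (Y p) (Z p).

Lemma curv_powE (omega : bilinear_field M) k (X : 'I_(k.*2 + 2) -> vfield M) :
  curv_pow nabla (covariant_of omega) k X p =
  (-1) ^+ k * curv_tensor (h p) (S p) (omega p) k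
                [seq X i p | i <- enum 'I_(k.*2 + 2)].
Proof.
elim: k X => [|k IH] X.
  rewrite /= expr0 mul1r !enum_ordSl [enum 'I_0]size0nil ?size_enum_ord//=.
  by rewrite /covariant_of; congr (omega p _ (X _ p)); exact: val_inj.
rewrite [LHS]/=.
rewrite /curv_act exprS mulN1r mulNr; congr (- _).
have -> : [seq X i p | i <- enum 'I_(k.+1.*2 + 2)] =
    [:: X ord0 p, X (lift ord0 ord0) p &
      [seq X (lift ord0 (lift ord0 i)) p | i <- enum 'I_(k.*2 + 2)]].
  by rewrite (enum_ordSl (k.*2 + 2).+1) enum_ordSl /= -!map_comp.
rewrite -[curv_tensor _ _ _ k.+1 _]/(derivation (gauss (h p) (S p) (X ord0 p)
  (X (lift ord0 ord0) p)) (curv_tensor _ _ _ k) _).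
rewrite derivation_sum mulr_sumr.
apply: eq_bigr => i _; rewrite IH; congr (_ * curv_tensor _ _ _ _ _).
by apply: eq_map => j /=; case: ifP => // _; rewrite gauss_eq.
Qed.

End CurvaturePowers.

Theorem theorem3p15 (R : realType) (M : manifold R 4)
    (M_connected : connected [set: M]) (M_orientable : orientable M)
    (f xi : M -> 'rV[R]_5) (f_immersion : immersion f)
    (xi_transversal : transversal_field f xi)
    (nabla : vfield M -> vfield M -> vfield M) (h : bilinear_field M)
    (S : endo_field M) (tau : form1 M)
    (induced : induced_by f xi nabla h S tau)
    (h_nondegenerate : nondegenerate_field h)
    (xi_locally_equiaffine : closed1 tau)
    (omega : bilinear_field M) (omega_symplectic : almost_symplectic omega)
    (k : nat) (k_ge1 : (1 <= k)%N)
    (Rk_omega : forall (X : 'I_(k.*2 + 2) -> vfield M) (p : M),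
       curv_pow nabla (covariant_of omega) k X p = 0)
    (h_lorentzian : forall p : M, has_signature (h p) 3 1) :
  forall p : M, rank_le (S p) 1.
Proof.
move=> p; have [e e_basis e_orth] := h_lorentzian p.
have [omega_alt omega_nondeg] := omega_symplectic.
have e_expand (v : tangent p) :
    v = \sum_(i < 4) ((if (i < 3)%N then 1 else -1) * h p v (e i)) *: e i.
  have [c [vE _]] := e_basis v; rewrite {1}vE.
  apply: eq_bigr => i _; congr (_ *: _); rewrite vE linear_sumlz (bigD1 i)//=.
  rewrite big1 ?addr0 => [|j ji]; last first.
    by rewrite linearZl_LR /= e_orth (negPf ji) mulr0.
  by rewrite linearZl_LR /= e_orth eqxx; case: ifP => _; ring.
have U0 l : curv_tensor (h p) (S p) (omega p) k l = 0.
  have [sl|] := eqVneq (size l) (k.*2 + 2)%N; last exact: curv_tensor_size.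
  (* The hypothesis speaks of vector fields, so each tangent vector of the list is extended to a
     global field. *)
  pose ext (v : tangent p) :=
    projT1 (cid (vfield_through f_immersion xi_transversal v)).
  have extE v : ext v p = v by rewrite /ext; case: cid.
  have := Rk_omega (fun i => ext (nth 0 l i)) p.
  rewrite (curv_powE (fun X Y Z =>
    gauss_equation f_immersion xi_transversal induced X Y Z p)).
  have -> : [seq ext (nth 0 l i) p | i : 'I__ <- enum 'I_(k.*2 + 2)] = l.
    rewrite (eq_map (fun i : 'I_(k.*2 + 2) => extE (nth 0 l i))).
    by rewrite -[RHS](mkseq_nth 0) sl /mkseq -val_enum_ord -map_comp.
  by move/eqP; rewrite mulf_eq0 signr_eq0 => /eqP.
case: k k_ge1 U0 {Rk_omega} => // k _ U0.
have [w wE] := curv_tensor_line_image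
  (h_symmetric f_immersion xi_transversal induced (p := p)) e_orth e_expand
  (fun u v => shape_symmetric f_immersion xi_transversal induced u v
                xi_locally_equiaffine)
  (omega_alt p) (omega_nondeg p) U0.
exists (fun=> w) => v; have [c ->] := wE v.
by exists (const_mx c); rewrite big_ord1 mxE.
Qed.
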